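(* Let $a,b\in\mathbb{P}$, $(\alpha,\beta)\in\mathrm{BP}(a,b)$ and $l\in\mathbb{N}$. If $\alpha=[a]$, then $$|\mathrm{OP}(a,b,[a],\beta,l)|=\sum_{\eta\in\mathrm{OT}(\lambda_{a,b,[a],\beta},l)}\binom{a+\mathcal{A}(<,\eta)}{l},$$ and if $\beta=[b]$, then $$|\mathrm{OP}(a,b,\alpha,[b],l)|=\sum_{\eta\in\mathrm{OT}(\lambda_{a,b,\alpha,[b]},l)}\binom{b+\mathcal{A}(>,\eta)}{l}.$$
   Context: Notation: $\mathbb{P}$ is the set of positive integers, $\mathbb{N}$ the set of nonnegative integers, $[m,n]=\{m,m+1,\ldots,n\}$ ($=\emptyset$ if $n<m$), $[n]=[1,n]$. Osculating paths. For $a,b\in\mathbb{P}$, $[a]\times[b]$ is a rectangle of lattice points with matrix labelling ($(i,j)$ is in row $i$ from the top and column $j$ from the left). $\mathrm{BP}(a,b)$ is the set of pairs $(\alpha,\beta)$ with $\alpha\subset[a]$, $\beta\subset[b]$, $|\alpha|=|\beta|$; elements are labelled in increasing order, $\alpha=\{\alpha_1<\ldots<\alpha_r\}$, $\beta=\{\beta_1<\ldots<\beta_r\}$. For $x\in[a]$, $y\in[b]$, $\Pi(a,b,x,y)$ is the set of paths $Q=(Q_0,\ldots,Q_L)$ with $Q_0=(a,y)$, $Q_L=(x,b)$ and each step $Q_m-Q_{m-1}\in\{(0,1),(-1,0)\}$. For $x<x'$ and $y<y'$, paths $Q\in\Pi(a,b,x,y)$ and $Q'\in\Pi(a,b,x',y')$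 are osculating if whenever $Q_m=Q'_{m'}=(i,j)$, then $Q_{m-1}=(i,j-1)$, $Q_{m+1}=(i-1,j)$, $Q'_{m'-1}=(i+1,j)$ (unless $m'=0$) and $Q'_{m'+1}=(i,j+1)$ (unless $Q'_{m'}$ is the last point of $Q'$). $\mathrm{OP}(a,b,\alpha,\beta)$ is the set of $r$-tuples $P=(P_1,\ldots,P_r)$ with $P_k\in\Pi(a,b,\alpha_k,\beta_k)$ and $P_k,P_{k+1}$ osculating for each $k\in[r-1]$. $Z(P)$ is the set of all points of $[a]\times[b]$ through which either no path of $P$ passes (vacancies) or two paths of $P$ pass (osculations). $\mathrm{OP}(a,b,\alpha,\beta,l)$ is the set of $P\in\mathrm{OP}(a,b,\alpha,\beta)$ with $|Z(P)|=l$. Partitions. A partition is a weakly decreasing infinite sequence $\lambda=(\lambda_1,\lambda_2,\ldots)$ of nonnegative integers with finitely many nonzero terms; $\ell(\lambda)$ is the number of nonzero terms, $\lambda^t$ the conjugate, $Y(\lambda)=\{(i,j)\in\mathbb{P}^2\mid i\le\ell(\lambda),\,j\le\lambda_i\}$, and $\emptyset$ is the empty partition. For integers $\gamma_1>\ldots>\gamma_r\ge0$ and $\delta_1>\ldots>\delta_r\ge0$, $(\gamma_1,\ldots,\gamma_r\,|\,\delta_1,\ldots,\delta_r)$ (Frobenius notation) is the unique partition $\lambda$ with exactly $r$ indices $i$ satisfying $\lambda_i\ge i$, and with $\lambda_i-i=\gamma_i$, $\lambda^t_i-i=\delta_i$ for $i\in[r]$. For $\lambda$ with $\ell(\lambda)\le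 a$ and $\lambda_1\le b$, $[a]\times[b]\setminus\lambda:=(b-\lambda_a,b-\lambda_{a-1},\ldots,b-\lambda_1)$. For $(\alpha,\beta)\in\mathrm{BP}(a,b)$, $\lambda_{a,b,\alpha,\beta}:=[a]\times[b]\setminus(b-\beta_1,\ldots,b-\beta_r\,|\,a-\alpha_1,\ldots,a-\alpha_r)$. Partitions $\lambda,\mu$ differ by a square, $\lambda\sim\mu$, if one of $Y(\lambda),Y(\mu)$ is the disjoint union of the other and a single point $(i,j)$; then $\Delta(\lambda,\mu):=j-i$. Oscillating tableaux. $\mathrm{OT}(\lambda,l)$ is the set of sequences $\eta=(\eta_0=\emptyset,\eta_1,\ldots,\eta_l=\lambda)$ of partitions with $\eta_{k-1}\sim\eta_k$ for $k\in[l]$. For $\eta\in\mathrm{OT}(\lambda,l)$, $\Omega(\eta)_k=\Delta(\eta_{k-1},\eta_k)$ for $k\in[l]$. For a strict total order $\prec$ on $\mathbb{Z}$, $\mathcal{A}(\prec,\eta):=|\{k\in[l-1]\mid\Omega(\eta)_k\prec\Omega(\eta)_{k+1}\}|$ is the number of ascents of $\eta$ with respect to $\prec$; here $<$ and $>$ are the usual less-than and greater-than relations on $\mathbb{Z}$. Binomial coefficients $\binom{m}{l}$ with $0\le m<l$ are $0$. *)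

(* Defs.v *)
From mathcomp Require Import all_boot all_order all_algebra.
From mathcomp Require Import boolp classical_sets functions cardinality fsbigop.
From mathcomp Require Import zify.

Set Implicit Arguments.
Unset Strict Implicit.
Unset Printing Implicit Defensive.

Local Open Scope classical_set_scope.
Local Open Scope nat_scope.

(** * Osculating paths *)

(* [(i, j)] is the lattice point in row [i] from the top and column [j] from
   the left; rows and columns are numbered from 1. *)
Definition point : Type := (nat * nat)%type.

(* A subset of [[n]] = {1, ..., n} is a [{set 'I_n}], the ordinal [i] standing
   for the integer [i + 1]; [labels A] lists the corresponding integers in
   increasing order. *)
Definition labels (n : nat) (A : {set 'I_n}) : seq nat :=
  [seq (nat_of_ord i).+1 | i <- enum A].

Definition BP (a b : nat) : {set {set 'I_a} * {set 'I_b}} :=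
  finset (fun p : {set 'I_a} * {set 'I_b} => #|p.1| == #|p.2|).

(* [q - p] is (0, 1) or (-1, 0). *)
Definition step (p q : point) : bool :=
  (q == (p.1, p.2.+1)) || (p == (q.1.+1, q.2)).

Definition paths (a b x y : nat) : set (seq point) :=
  [set Q | exists Q', [/\ Q = (a, y) :: Q', path step (a, y) Q' &
                          last (a, y) Q' = (x, b)]].

(* To be used with [Q] the path ending in the upper row.  As [onth] returns
   [Some] only for indices inside the path, the unconditional clauses also say
   that the neighbouring points of [Q] exist. *)
Definition osculating (Q Q' : seq point) : Prop :=
  forall m m' i j, onth Q m = Some (i, j) -> onth Q' m' = Some (i, j) ->
  [/\ 0 < m /\ onth Q m.-1 = Some (i, j.-1),
      onth Q m.+1 = Some (i.-1, j),
      m' <> 0 -> onth Q' m'.-1 = Some (i.+1, j) &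
      m'.+1 <> size Q' -> onth Q' m'.+1 = Some (i, j.+1)].

Definition OP (a b : nat) (alpha : {set 'I_a}) (beta : {set 'I_b}) :
    set (seq (seq point)) :=
  [set P | [/\ size P = #|alpha|,
      forall k, k < #|alpha| ->
        paths a b (nth 0 (labels alpha) k) (nth 0 (labels beta) k)
                  (nth [::] P k) &
      forall k, k.+1 < #|alpha| ->
        osculating (nth [::] P k) (nth [::] P k.+1)]].

(* At most two paths of an element of [OP] pass through any given point. *)
Definition Z (a b : nat) (P : seq (seq point)) : {set 'I_a * 'I_b} :=
  finset (fun p : 'I_a * 'I_b =>
    let n := count (fun Q => (p.1.+1, p.2.+1) \in Q) P in
    (n == 0) || (n == 2)).

Definition OPl (a b : nat) (alpha : {set 'I_a}) (beta : {set 'I_b}) (l : nat) :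
    set (seq (seq point)) :=
  [set P | OP alpha beta P /\ #|Z a b P| = l].

(** * Partitions *)

(* A partition is represented by the list of its nonzero terms, so that equal
   partitions are equal lists and [size lam] is the length of [lam]. *)
Definition is_partition (lam : seq nat) : bool :=
  sorted geq lam && all (fun x => 0 < x) lam.

(* The [i]-th term, for [i >= 1]. *)
Definition part (lam : seq nat) (i : nat) : nat := nth 0 lam i.-1.

(* The [j]-th term of the conjugate partition, for [j >= 1]. *)
Definition conj_part (lam : seq nat) (j : nat) : nat :=
  count (fun x => j <= x) lam.

Definition Y (lam : seq nat) : set point :=
  [set p | 1 <= p.1 <= size lam /\ 1 <= p.2 <= part lam p.1].

Definition is_frobenius (gamma delta lam : seq nat) : Prop :=
  [/\ is_partition lam,
      count (fun i => i <= part lam i) (iota 1 (size lam)) = size gamma,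
      forall i, 1 <= i <= size gamma -> part lam i = nth 0 gamma i.-1 + i &
      forall i, 1 <= i <= size gamma -> conj_part lam i = nth 0 delta i.-1 + i].

(* The partition (gamma | delta); for strictly decreasing [gamma] and [delta] of
   the same size it exists and is unique by [frobenius_exists] and
   [frobenius_unique] below. *)
Definition frobenius (gamma delta : seq nat) : seq nat :=
  xget [::] [set lam | is_frobenius gamma delta lam].

(* [a] x [b] \ lam = (b - lam_a, ..., b - lam_1), without its trailing zeros;
   only meaningful if lam fits in the [a] x [b] rectangle. *)
Definition rect_compl (a b : nat) (lam : seq nat) : seq nat :=
  [seq x <- [seq b - part lam i | i <- rev (iota 1 a)] | 0 < x].

Definition lambda_of (a b : nat) (alpha : {set 'I_a}) (beta : {set 'I_b}) :
    seq nat :=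
  rect_compl a b (frobenius [seq b - x | x <- labels beta]
                            [seq a - x | x <- labels alpha]).

Definition adds_square (lam mu : seq nat) (p : point) : Prop :=
  ~ Y lam p /\ Y mu = Y lam `|` [set p].

Definition differ_by (lam mu : seq nat) (p : point) : Prop :=
  adds_square lam mu p \/ adds_square mu lam p.

Definition differ_by_square (lam mu : seq nat) : Prop :=
  exists p, differ_by lam mu p.

(* The content j - i of the square (i, j) by which lam and mu differ, which is
   unique by [differ_by_unique]. *)
Definition Delta (lam mu : seq nat) : int :=
  let p := xget (0, 0) [set p | differ_by lam mu p] in
  (Posz p.2 - Posz p.1)%R.

(** * Oscillating tableaux *)

(* A finite set by [finite_OT], so finitely supported sums over it are genuine
   sums. *)
Definition OT (lam : seq nat) (l : nat) : set (seq (seq nat)) :=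
  [set eta | [/\ size eta = l.+1,
      all is_partition eta,
      nth [::] eta 0 = [::],
      nth [::] eta l = lam &
      forall k, 1 <= k <= l ->
        differ_by_square (nth [::] eta k.-1) (nth [::] eta k)]].

Definition Omega (eta : seq (seq nat)) (k : nat) : int :=
  Delta (nth [::] eta k.-1) (nth [::] eta k).

(* The list [eta] = (eta_0, ..., eta_l) has l + 1 terms, so k ranges over
   {1, ..., l - 1}. *)
Definition ascents (prec : rel int) (eta : seq (seq nat)) : nat :=
  count (fun k => prec (Omega eta k) (Omega eta k.+1))
        (iota 1 (size eta).-2).

(** * Well-posedness of the definitions *)

Lemma differ_by_unique lam mu p q :
  differ_by lam mu p -> differ_by lam mu q -> p = q.
Proof.
have sub l m r : adds_square l m r -> Y l `<=` Y m /\ Y m r.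
  by move=> [_ ->]; split; [left | right].
have same l m r s : adds_square l m r -> adds_square l m s -> r = s.
  move=> lr [ns e]; have [nr _] := lr; have [_] := sub _ _ _ lr.
  by rewrite e => -[/nr|].
have opp l m r s : adds_square l m r -> ~ adds_square m l s.
  move=> lr ms; have [nr _] := lr; have [_ mr] := sub _ _ _ lr.
  by have [/(_ _ mr)] := sub _ _ _ ms.
move=> [H|H] [K|K]; [exact: same H K|case: (opp _ _ _ _ H K)| |exact: same H K].
by case: (opp _ _ _ _ K H).
Qed.

Lemma nth_count_geq (s : seq nat) i j : sorted geq s -> 0 < j ->
  (i < count (leq j) s) = (j <= nth 0 s i).
Proof.
move=> ss j0; elim: s i ss => [|x s IH] i; first by rewrite nth_nil /=; lia.
move=> /= xs; have ss := path_sorted xs.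
have sx : all (geq x) s.
  by apply: order_path_min xs => y z t /= zy ty; exact: leq_trans ty zy.
have [jx|xj] := leqP j x; first by case: i => [|i] //=; rewrite add1n ltnS IH.
have -> : count (leq j) s = 0.
  apply/eqP; rewrite -leqn0 leqNgt -has_count; apply/hasPn => y ys.
  by have := allP sx y ys => /=; lia.
case: i => [|i] /=; first by lia.
have [si|si] := leqP (size s) i; first by rewrite nth_default //; lia.
by have := allP sx _ (mem_nth 0 si) => /=; lia.
Qed.

Lemma conj_partE lam i j : is_partition lam -> 0 < i -> 0 < j ->
  (i <= conj_part lam j) = (j <= part lam i).
Proof. by case: i => // i /andP[ss _] _ j0; rewrite /conj_part nth_count_geq. Qed.

Lemma part_mono lam i j : is_partition lam -> 0 < i -> i <= j ->
  part lam j <= part lam i.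
Proof.
move=> pl i0 ij; have [->//|l0] := posnP (part lam j).
by rewrite -conj_partE // (leq_trans ij) // conj_partE //; lia.
Qed.

Lemma part_inj lam mu : is_partition lam -> is_partition mu ->
  (forall i, 0 < i -> part lam i = part mu i) -> lam = mu.
Proof.
move=> pl pm e; have sz l i : is_partition l -> (i < size l) = (0 < nth 0 l i).
  move=> /andP[_ /all_nthP pos]; case: ltnP => il; last by rewrite nth_default.
  by rewrite pos.
have en i : nth 0 lam i = nth 0 mu i by have := e i.+1 isT.
apply: (@eq_from_nth _ 0) => [|i _]; last exact: en.
have H i : (i < size lam) = (i < size mu) by rewrite !sz // en.
by apply/eqP; rewrite eqn_leq leqNgt (H (size mu)) ltnn leqNgt -(H (size lam)) ltnn.
Qed.

Lemma frobenius_unique gamma delta lam mu :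
  is_frobenius gamma delta lam -> is_frobenius gamma delta mu -> lam = mu.
Proof.
have key l i j : is_frobenius gamma delta l -> size gamma < i -> 0 < j ->
    (j <= part l i) = (j <= size gamma) && (i <= nth 0 delta j.-1 + j).
  move=> [pl dl gl cl] ri j0; have [jr|rj] := leqP j (size gamma).
    by rewrite -cl ?j0 // conj_partE //; lia.
  apply/negP => ji; set r := size gamma in dl ri rj.
  have big k : 0 < k -> k <= r.+1 -> r < part l k.
    move=> k0 kr; apply: (leq_trans rj (leq_trans ji _)).
    by apply: part_mono => //; lia.
  have rl : r.+1 <= size l.
    rewrite leqNgt; apply/negP => lr; have := big r.+1 isT (leqnn _).
    by rewrite /part nth_default //=; lia.
  move: dl; rewrite -(subnKC rl) iotaD count_cat.
  suff -> : count (fun i => i <= part l i) (iota 1 r.+1) = r.+1 by lia.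
  rewrite -{2}(size_iota 1 r.+1); apply/eqP; rewrite -all_count; apply/allP => k.
  by rewrite mem_iota => /andP[k1 k2]; have := big k k1 ltac:(lia); lia.
move=> fl fm; have [pl _ gl _] := fl; have [pm _ gm _] := fm.
apply: part_inj => // i i0.
have [ir|ri] := leqP i (size gamma); first by rewrite gl ?gm ?i0.
apply/eqP; rewrite eqn_leq; apply/andP; split.
  have [->//|l0] := posnP (part lam i).
  by rewrite (key mu) // -(key lam).
have [->//|l0] := posnP (part mu i).
by rewrite (key lam) // -(key mu).
Qed.

Lemma sorted_gtn_nth (s : seq nat) i j : sorted gtn s -> i <= j -> j < size s ->
  nth 0 s j + j <= nth 0 s i + i.
Proof.
move=> ss; elim: j => [|j IH] ij js; first by have -> : i = 0 by lia.
have [->//|ne] := eqVneq i j.+1.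
apply: leq_trans (IH ltac:(lia) ltac:(lia)).
have tr : transitive gtn by move=> y x z /= ? ?; lia.
move: ss; rewrite sorted_pairwise // => /(pairwiseP 0) /(_ j j.+1).
by rewrite !inE /= => /(_ ltac:(lia) js (ltnSn j)); lia.
Qed.

Lemma count_iota_lt (p : pred nat) m n k : k <= n ->
  (forall i, i < n -> p (m + i) = (i < k)) -> count p (iota m n) = k.
Proof.
move=> kn pk; rewrite -(subnKC kn) iotaD count_cat.
have -> : count p (iota m k) = k.
  rewrite -{2}(size_iota m k); apply/eqP; rewrite -all_count; apply/allP => i.
  by rewrite mem_iota => ik; have := pk (i - m); rewrite subnKC; lia.
suff -> : count p (iota (m + k) (n - k)) = 0 by rewrite addn0.
apply/eqP; rewrite -leqn0 leqNgt -has_count; apply/hasPn => i.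
by rewrite mem_iota => ik; have := pk (i - m); rewrite subnKC; lia.
Qed.

Lemma frobenius_exists gamma delta :
  size gamma = size delta -> sorted gtn gamma -> sorted gtn delta ->
  is_frobenius gamma delta (frobenius gamma delta).
Proof.
move=> gd sg sd; apply: (@xgetPex _ [::] [set lam | is_frobenius gamma delta lam]).
set r := size gamma; pose g := nth 0 gamma; pose d := nth 0 delta.
pose c i := count (fun j => i <= d j + j) (iota 0 r).
pose f i := if i < r then g i + i.+1 else c i.
pose n := if r is 0 then 0 else (d 0).+1.
have gi i : i < r -> r <= g i + i.+1.
  move=> ir; have := @sorted_gtn_nth gamma i r.-1 sg.
  by rewrite -/r -/g; move=> /(_ ltac:(lia) ltac:(lia)); lia.
have dij i j : i <= j -> j < r -> d j + j <= d i + i.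
  by move=> ij jr; apply: sorted_gtn_nth => //; rewrite -gd.
have di i : i < r -> r <= d i + i.+1.
  by move=> ir; have := dij i r.-1 ltac:(lia) ltac:(lia); lia.
have dn k : k < r -> d k + k < n.
  by move=> kr; have := dij 0 k isT kr; rewrite /n; case: (r) kr => //; lia.
have rn : r <= n by rewrite /n; case E: r => [//|r']; have := di 0; lia.
have cr i : c i <= r by rewrite /c -{2}(size_iota 0 r) count_size.
have ck i k : k < r -> (k < c i) = (i <= d k + k).
  move=> kr; rewrite /c -(subnKC kr) iotaD count_cat.
  have cc a s : count (fun j => i <= d j + j) (iota a s) <= s.
    by rewrite -{2}(size_iota a s) count_size.
  case: (leqP i (d k + k)) => H.
    suff -> : count (fun j => i <= d j + j) (iota 0 k.+1) = k.+1 by lia.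
    apply: count_iota_lt => // j jk; rewrite add0n jk.
    by apply: leq_trans H (dij _ _ _ _).
  have -> : count (fun j => i <= d j + j) (iota (0 + k.+1) (r - k.+1)) = 0.
    apply: count_iota_lt => // j jk; rewrite ltn0; apply/negbTE; rewrite -ltnNge.
    by apply: leq_ltn_trans H; apply: dij; lia.
  rewrite -addn1 iotaD count_cat /= add0n; have := cc 0 k; lia.
have pf i : 0 < i -> i <= n -> part (mkseq f n) i = f i.-1.
  by move=> i0 ir; rewrite /part nth_mkseq //; lia.
have fS i : f i.+1 <= f i.
  rewrite /f; have [ir|ir] := ltnP i.+1 r.
    rewrite (ltnW ir); have := @sorted_gtn_nth gamma i i.+1 sg (leqnSn _) ir.
    by rewrite -/g; lia.
  have [ir'|ir'] := ltnP i r; first by have := gi i ir'; have := cr i.+1; lia.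
  by apply: sub_count => j /=; lia.
exists (mkseq f n); split.
- apply/andP; split; last first.
    apply/allP => x /mapP[i]; rewrite mem_iota /= => lin ->.
    rewrite /f; case: (ltnP i r) => ir; first by lia.
    have r0 : 0 < r by move: lin; rewrite /n; case: (r) => //; lia.
    by rewrite ck // addn0; move: lin; rewrite /n; case: (r) r0 => //; lia.
  apply: (@homo_sorted _ _ f (fun i j => j == i.+1) geq) => [i j /eqP-> //|].
    exact: fS.
  rewrite {pf}; elim: n {dn rn} 0 => //= m IH k.
  by case: m IH => //= m /(_ k.+1) /= ->; rewrite eqxx.
- rewrite size_mkseq; apply: count_iota_lt => // i ilt.
  rewrite pf //=; rewrite /f; case: (ltnP i r) => ir; first by lia.
  by rewrite add0n; have := cr i; lia.
- by move=> i /andP[i0 ir]; rewrite pf //; rewrite /f ?ifT -/g; lia.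
- move=> i /andP[i0 ir]; rewrite /conj_part /mkseq count_map -/d.
  have -> : d i.-1 + i = (d i.-1 + i.-1).+1 by lia.
  apply: count_iota_lt => [|j jn]; first by apply: dn; lia.
  rewrite add0n /= /f; case: (ltnP j r) => jr.
    by have := gi j jr; have := di i.-1; lia.
  by have := ck j i.-1; rewrite prednK // ltnS; apply; lia.
Qed.

Lemma finite_lists (T : choiceType) (A : set T) n : finite_set A ->
  finite_set [set s : seq T | size s = n /\ {in s, forall x, A x}].
Proof.
move=> fA; elim: n => [|n IH].
  by apply: (sub_finite_set _ (finite_set1 [::])) => s [/size0nil ->].
apply: sub_finite_set (finite_image2 (fun x s => x :: s) fA IH).
move=> [|x s] [] //= [sn] As; exists x; first by apply: As; rewrite inE eqxx.
by exists s => //; split=> // y ys; apply: As; rewrite inE ys orbT.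
Qed.

Lemma finite_OT lam l : finite_set (OT lam l).
Proof.
pose bnd (mu : seq nat) n := forall q, Y mu q -> q.1 <= n /\ q.2 <= n.
have grow m1 m2 p n : is_partition m2 -> differ_by m1 m2 p ->
    bnd m1 n -> bnd m2 n.+1.
  move=> pm [[_ e] b|[_ e] b q Yq]; last first.
    by have [] := b q; [rewrite e; left | lia].
  have Y1 q : Y m2 q -> q <> p -> Y m1 q by rewrite e => -[|].
  have Y2 q : Y m2 q -> (1 < q.1 -> Y m2 (q.1.-1, q.2)) /\
                        (1 < q.2 -> Y m2 (q.1, q.2.-1)).
    move=> [/= q1 q2]; have := @part_mono m2 q.1.-1 q.1 pm; rewrite /Y/=.
    by split=> ?; split=> /=; lia.
  move=> q Yq; have [ur lf] := Y2 q Yq; split; rewrite leqNgt; apply/negP => H.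
    have [u|u] := pselect ((q.1.-1, q.2) = p); last first.
      by have [/=] := b _ (Y1 _ (ur ltac:(lia)) u); lia.
    have /b[] : Y m1 q.
      apply: Y1 => // qp; move: u.
      by rewrite -qp [q in _ = q]surjective_pairing => -[]; lia.
    by lia.
  have [u|u] := pselect ((q.1, q.2.-1) = p); last first.
    by have [/=] := b _ (Y1 _ (lf ltac:(lia)) u); lia.
  have /b[] : Y m1 q.
      apply: Y1 => // qp; move: u.
      by rewrite -qp [q in _ = q]surjective_pairing => -[]; lia.
  by lia.
pose A := [set s : seq nat | size s <= l /\ {in s, forall x, x <= l}].
have fA : finite_set A.
  pose B k := [set s : seq nat | size s = k /\ {in s, forall x, `I_l.+1 x}].
  apply: (@sub_finite_set _ _ (\bigcup_(k in `I_l.+1) B k)).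
    by move=> s [sl Hs]; exists (size s) => //=; split=> // x /Hs.
  by apply: bigcup_finite => // k _; exact: finite_lists.
apply: sub_finite_set (finite_lists l.+1 fA) => eta [sz pe e0 _ st].
split=> // mu /(nthP [::])[k]; rewrite sz ltnS => kl <-.
have pk j : j <= l -> is_partition (nth [::] eta j).
  by move=> jl; move/all_nthP: pe; apply; rewrite sz.
have bk : bnd (nth [::] eta k) k.
  elim: k kl => [|k IH] kl; first by rewrite e0 => q [/=]; lia.
  have [p dp] := st k.+1 ltac:(lia).
  by apply: grow dp (IH ltac:(lia)); exact: pk.
have pos i : i < size (nth [::] eta k) -> 0 < nth 0 (nth [::] eta k) i.
  by have /andP[_ /all_nthP] := pk k kl; apply.
split.
  case E: (size _) => [//|n]; have := pos n; rewrite E => /(_ (leqnn _)) n0.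
  have /= := bk (n.+1, 1); rewrite /Y /part E /= => -[|nk _].
    by split; [exact: ltnSn | exact: n0].
  exact: leq_trans nk kl.
move=> x /(nthP 0)[i il <-]; have := pos i il => i0.
have /= := bk (i.+1, nth 0 (nth [::] eta k) i); rewrite /Y /part /= => -[|_ xk].
  by rewrite il i0 leqnn.
exact: leq_trans xk kl.
Qed.

(* Main.v *)
(* Peel the rows of the lattice off from the bottom.  If every row contains the
   end of a path, an element of OP(a, b, [a], beta) is a chain of column sets
   beta^(0), ..., beta^(a) = beta, the paths leaving row i upwards in the
   columns beta^(i-1) and entering it from below in the columns beta^(i), where
   consecutive sets interlace.  The boundary word of beta^(i) is that of a
   partition lambda^(i); scanning row i from left to right turns lambda^(i-1)
   into lambda^(i) by adding a square at each vacancy and deleting one at each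
   osculation, the point (i, j) acting on the diagonal of content j - i.  So a
   path tuple is an oscillating tableau cut into a blocks (one per row),
   possibly empty, along each of which the contents strictly increase.  A
   tableau of length l >= 1 with A ascents has l - 1 - A forced cuts, hence
   binom(a + A, l) ways to be cut.  The case beta = [b] follows by transposing
   paths and conjugating partitions. *)

Require Import Defs.
From mathcomp Require Import all_boot all_order all_algebra.
From mathcomp Require Import boolp classical_sets functions cardinality fsbigop.
From mathcomp Require Import zify.
From mathcomp Require finmap.

Set Implicit Arguments.
Unset Strict Implicit.
Unset Printing Implicit Defensive.

Local Open Scope classical_set_scope.
Local Open Scope card_scope.
Local Open Scope nat_scope.

(** * Squares added to or removed from a partition, and their contents *)

Lemma mem_Y lam i j : Y lam (i, j) <-> [/\ 0 < i, 0 < j & j <= part lam i].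
Proof.
rewrite /Y /part /=; split; first by move=> [] ? ?; split; lia.
move=> [i0 j0 ji]; split; last lia.
rewrite i0 leqNgt; apply/negP => si; move: ji; rewrite nth_default; lia.
Qed.

(** Turns the relation between sets of squares into linear arithmetic on row lengths, the form in
    which neighbouring partitions are compared below. *)
Lemma adds_squareP lam mu i j : adds_square lam mu (i, j) <->
  [/\ 0 < i, part mu i = (part lam i).+1, j = part mu i &
      forall k, 0 < k -> k <> i -> part mu k = part lam k].
Proof.
split=> [[nY eY]|[i0 e1 e2 e3]]; last first.
  split; first by move/mem_Y => []; lia.
  apply/seteqP; split=> [[k m] /mem_Y[k0 m0 km]|[k m]].
    have [ki|/eqP ki] := eqVneq k i; last first.
      by left; apply/mem_Y; split=> //; rewrite -e3.
    have [mj|mj] := eqVneq m j; first by right; rewrite ki mj.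
    by left; apply/mem_Y; split=> //; move: km mj; rewrite ki; lia.
  move=> [/mem_Y[k0 m0 km]|[-> ->]]; last by apply/mem_Y; split; lia.
  apply/mem_Y; split=> //; have [ki|/eqP ki] := eqVneq k i; last by rewrite e3.
  by move: km; rewrite ki; lia.
have /mem_Y[i0 j0 ji] : Y mu (i, j) by rewrite eY; right.
have H k m : 0 < k -> 0 < m ->
    (m <= part mu k) <-> (m <= part lam k \/ (k = i /\ m = j)).
  move=> k0 m0; have -> : (m <= part mu k) <-> Y mu (k, m).
    by rewrite mem_Y; split=> [|[]].
  rewrite eY; split=> [[/mem_Y[]|[-> ->]]|[mk|[-> ->]]]; [by left|by right| |].
    by left; apply/mem_Y.
  by right.
have e3 k : 0 < k -> k <> i -> part mu k = part lam k.
  move=> k0 ki; apply/eqP; rewrite eqn_leq; apply/andP; split.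
    have [->//|m0] := posnP (part mu k).
    by have [h _] := H k (part mu k) k0 m0; case: (h (leqnn _)) => [//|[]].
  have [->//|m0] := posnP (part lam k).
  by have [_ h] := H k (part lam k) k0 m0; apply: h; left.
have nj : part lam i < j.
  by rewrite ltnNge; apply/negP => H1; apply: nY; apply/mem_Y.
have m1 : part mu i <= j.
  have [->//|m0] := posnP (part mu i).
  by have [h _] := H i (part mu i) i0 m0; case: (h (leqnn _)); lia.
have ej : j = part mu i by lia.
have [j1|j1] := posnP j.-1; first by split=> //; lia.
by have [h _] := H i j.-1 i0 j1; case: h; [lia | split=> //; lia | lia].
Qed.

Definition content (p : nat * nat) : int := (Posz p.2 - Posz p.1)%R.

Lemma DeltaE lam mu p : differ_by lam mu p -> Delta lam mu = content p.
Proof.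
move=> d; rewrite /Delta; case: xgetP => [q -> dq|/(_ p)//].
by rewrite (differ_by_unique d dq).
Qed.

Lemma part_gt_size lam i : is_partition lam -> 0 < i ->
  (i <= size lam) = (0 < part lam i).
Proof.
case: i => // i /andP[_ /(all_nthP 0) pos] _; rewrite /part /=.
by case: ltnP => il; [rewrite pos | rewrite nth_default].
Qed.

Lemma part_lt lam i k : is_partition lam -> 0 < i -> i < k ->
  part lam k <= part lam i.
Proof. by move=> pl i0 /ltnW; exact: part_mono. Qed.

(** Along a diagonal the column index grows with the row index while row lengths weakly decrease. So
    at most one square of a given content can be added to or removed from [lam], and the content
    alone determines the neighbour. *)
Lemma differ_content_inj lam mu nu p q :
  is_partition lam -> is_partition mu -> is_partition nu ->
  differ_by mu lam p -> differ_by nu lam q -> content p = content q -> mu = nu.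
Proof.
case: p q => [i j] [k m] pl pm pn; rewrite /content /= => dm dn e.
have ik : i = k.
  case: dm dn => /adds_squareP[i0 e1 e2 e3] [] /adds_squareP[k0 f1 f2 f3].
  - have [||//] := ltngtP i k => h.
    + by have := part_lt pl i0 h; lia.
    + by have := part_lt pl k0 h; lia.
  - have [||//] := ltngtP i k => h.
    + have := part_lt pm i0 h; have := e3 k k0 ltac:(lia).
      have := part_lt pn i0 h; lia.
    + have := part_lt pn k0 h; have := f3 i i0 ltac:(lia).
      have := part_lt pm k0 h; lia.
  - have [||//] := ltngtP i k => h.
    + have := part_lt pm i0 h; have := e3 k k0 ltac:(lia).
      have := part_lt pn i0 h; lia.
    + have := part_lt pn k0 h; have := f3 i i0 ltac:(lia).
      have := part_lt pm k0 h; lia.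
  - have [||//] := ltngtP i k => h.
    + by have := part_lt pl i0 h; have := part_lt pm i0 h; have := e3 k k0; lia.
    + by have := part_lt pl k0 h; have := part_lt pn k0 h; have := f3 i i0; lia.
subst k; have jm : j = m by lia.
subst m; apply: part_inj => // r r0.
case: dm dn => /adds_squareP[i0 e1 e2 e3] [] /adds_squareP[k0 f1 f2 f3];
  have [->|/eqP ri] := eqVneq r i; have := e3 r r0; have := f3 r r0;
  try (move=> /(_ ri)); try (move=> + /(_ ri)); lia.
Qed.

(** * Boundary words *)

(* Words are read from right to left along the boundary of the partition: each
   letter [true] is a row, and the letters [false] after it are its squares. *)
Fixpoint rows (u : seq bool) : seq nat :=
  if u is p :: u' then
    if p then count negb u' :: rows u' else rows u'
  else [::].

Definition shape (u : seq bool) : seq nat := [seq x <- rows u | 0 < x].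

Lemma count_negb u : count negb u + count id u = size u.
Proof. by rewrite addnC -[RHS](count_predC id u). Qed.

Lemma size_rows u : size (rows u) = count id u.
Proof. by elim: u => //= -[] u /= ->. Qed.

Lemma rows_le u : all (geq (count negb u)) (rows u).
Proof.
elim: u => //= -[] u IH /=; first by rewrite leqnn add0n.
by apply: sub_all IH => x /=; lia.
Qed.

Lemma sorted_rows u : sorted geq (rows u).
Proof.
elim: u => //= -[] u IH //=; rewrite path_sortedE ?rows_le //.
by move=> x y z /= xy zx; exact: leq_trans zx xy.
Qed.

Lemma is_partition_shape u : is_partition (shape u).
Proof.
rewrite /is_partition filter_all andbT sorted_filter ?sorted_rows //.
by move=> x y z /= xy zx; exact: leq_trans zx xy.
Qed.

(** In a weakly decreasing list the zeros form the tail, where the default value is 0 as well. *)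
Lemma nth_filter_pos s i : sorted geq s -> nth 0 [seq x <- s | 0 < x] i = nth 0
  s i.
Proof.
elim: s i => // x s IH i; rewrite [sorted _ _]/= => xs.
case: x xs => [|x] xs /=; last by case: i => //= i;
  rewrite IH // (path_sorted xs).
have -> : [seq x <- s | 0 < x] = [::].
  apply/eqP; rewrite -[_ == _]negbK -has_filter; apply/hasPn => y ys.
  have : all (geq 0) s.
    by apply: order_path_min xs => y1 z t /= zy ty; exact: leq_trans ty zy.
  by move/allP/(_ y ys) => /=; lia.
rewrite nth_nil; case: i => //= i.
have : all (geq 0) s.
  by apply: order_path_min xs => y1 z t /= zy ty; exact: leq_trans ty zy.
have [si|si] := ltnP i (size s); last by rewrite nth_default.
by move/(all_nthP 0)/(_ i si) => /=; lia.
Qed.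

Lemma part_shape u i : part (shape u) i = nth 0 (rows u) i.-1.
Proof. by rewrite /part nth_filter_pos // sorted_rows. Qed.

Lemma rows_cat x y :
  rows (x ++ y) = [seq r + count negb y | r <- rows x] ++ rows y.
Proof. by elim: x => //= -[] x /= ->; rewrite ?count_cat. Qed.

(** The letter [true] moves before one more [false], so its row grows by one square; every other row
    keeps its number of later letters [false]. *)
Lemma adds_square_shape x y :
  adds_square (shape (x ++ false :: true :: y)) (shape (x ++ true :: false ::
    y))
    ((count id x).+1, (count negb y).+1).
Proof.
apply/adds_squareP; rewrite !part_shape !rows_cat /= -!size_rows.
have e n : size [seq r + n | r <- rows x] = size (rows x) by rewrite size_map.
rewrite !nth_cat !e ltnn subnn /=; split=> // -[//|k] _ /=.
rewrite !part_shape !rows_cat !nth_cat !e /=.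
case: ltnP => [//|xk] ne;
  suff -> : k - size (rows x) = (k - size (rows x)).-1.+1.
  by [].
lia.
Qed.

Lemma shape_swap x y p q : p != q ->
  differ_by (shape (x ++ p :: q :: y)) (shape (x ++ q :: p :: y))
    ((count id x).+1, (count negb y).+1).
Proof.
by case: p q => -[] // _; [right | left]; exact: adds_square_shape.
Qed.

(** The word is the Maya diagram of its shape: up to the shift by [count id u], the letters [true]
    sit at the numbers [part r - r]. The word is reversed because its head is the rightmost column.
    Rows [r] beyond the letters [true] have length 0 and would need a negative [s]. *)
Lemma nth_rev_shape u s :
  nth false (rev u) s <->
  exists2 r, 0 < r & part (shape u) r + count id u = s + r.
Proof.
suff: nth false (rev u) s <->
    exists2 r, 0 < r & nth 0 (rows u) r.-1 + count id u = s + r.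
  by move=> ->; split=> -[r r0 e]; exists r => //; move: e; rewrite part_shape.
elim: u s => [|p u IH] s /=.
  rewrite nth_nil; split=> // -[r r0]; rewrite nth_nil /=; lia.
have cn := count_negb u.
rewrite rev_cons nth_rcons size_rev; case: p => /=; last first.
  rewrite add0n -IH; case: ltngtP => [//|/ltnW|->]; last first.
    by rewrite nth_default // size_rev.
  by move=> su; rewrite nth_default // size_rev.
case: (ltngtP s (size u)) => [su|su|->]; last first.
- by split=> // _; exists 1 => //=; lia.
- split=> // -[[//|[|r]] _ /=]; first by lia.
  move=> e; suff : nth false (rev u) s by rewrite nth_default // size_rev ltnW.
  by apply/IH; exists r.+1 => //=; lia.
- rewrite IH; split=> [[r r0 e]|[[//|[|r]] _ /=]].
  + exists r.+1 => //=; case: r r0 e => //= r _; lia.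
  + by lia.
  + by move=> e; exists r.+1 => //=; lia.
Qed.

(** Let [c] be the content [j - i]. A removable square of content [c] ends a row with
    [part r - r = c], an addable one extends a row with [part r - r = c - 1]; in each case
    monotonicity of the rows excludes the other value. *)
Lemma differ_diag lam mu i j : is_partition lam -> is_partition mu ->
  differ_by mu lam (i, j) ->
  (exists2 r, 0 < r & part lam r + i = j + r) <->
  ~ (exists2 r, 0 < r & (part lam r).+1 + i = j + r).
Proof.
move=> pl pm [] /adds_squareP[i0 e1 e2 e3]; split.
- move=> _ [r r0 er]; case: (ltngtP i r) => h; last by subst r; lia.
    have := part_lt pm i0 h; have := e3 r r0 ltac:(lia); lia.
  by have := part_lt pl r0 h; lia.
- by move=> _; exists i => //; lia.
- move=> [r r0 er]; exfalso; case: (ltngtP i r) => h; last by subst r; lia.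
    by have := part_lt pl i0 h; lia.
  by have := part_lt pm r0 h; have := e3 r r0 ltac:(lia); lia.
- by case; exists i => //; lia.
Qed.

(** Two equal adjacent letters mean that the two consecutive values of [part r - r] both occur or
    both do not, against [differ_diag]. *)
Lemma shape_no_swap x y p mu d : is_partition mu ->
  differ_by mu (shape (x ++ p :: p :: y)) d ->
  content d <> (Posz (size y).+1 - Posz (count id (x ++ p :: p :: y)))%R.
Proof.
case: d => i j; set u := x ++ _ => pm dm; rewrite /content /= => e.
have := differ_diag (is_partition_shape u) pm dm.
have H s : size y <= s <= (size y).+1 -> nth false (rev u) s = p.
  have -> : rev u = (rev y ++ [:: p; p]) ++ rev x.
    by rewrite /u rev_cat !rev_cons -!cats1 -!catA.
  move=> sy; rewrite !nth_cat size_cat size_rev /=.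
  have -> : s < size y + 2 by lia.
  have -> : (s < size y) = false by lia.
  by have [->|->] : s - size y = 0 \/ s - size y = 1 by lia.
have a1 := nth_rev_shape u (size y).+1; have a2 := nth_rev_shape u (size y).
rewrite !H in a1 a2; [|lia|lia].
have b1 : (exists2 r, 0 < r & part (shape u) r + i = j + r) <-> p.
  by rewrite a1; split=> -[r r0 er]; exists r => //; lia.
have b2 : (exists2 r, 0 < r & (part (shape u) r).+1 + i = j + r) <-> p.
  by rewrite a2; split=> -[r r0 er]; exists r => //; lia.
by rewrite b1 b2; case: (p) => -[h1 h2]; [case: h1 | case: h2].
Qed.

(** * Weighted sums over oscillating tableaux *)

Definition OT_enum lam l : seq (seq (seq nat)) :=
  finmap.enum_fset (fset_set (OT lam l)).

Lemma mem_OT_enum lam l eta : (eta \in OT_enum lam l) <-> OT lam l eta.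
Proof.
have : eta \in OT_enum lam l = (eta \in OT lam l).
  exact: (in_fset_set (finite_OT lam l)).
by move=> ->; rewrite inE.
Qed.

Lemma uniq_OT_enum lam l : uniq (OT_enum lam l).
Proof. exact: finmap.fset_uniq. Qed.

Lemma OT_rcons lam l eta nu : OT lam l.+1 (rcons eta nu) <->
  [/\ nu = lam, is_partition lam &
      exists2 mu, OT mu l eta & differ_by_square mu lam].
Proof.
have e0 k s : size eta = s.+1 -> k <= s -> nth [::] (rcons eta nu) k = nth [::]
  eta k.
  by move=> se ks; rewrite nth_rcons se ltnS ks.
split=> [[]|[e pl [mu [se pe h0 hl hd] d]]].
  rewrite size_rcons all_rcons => -[se] /andP[pn pe] h0.
  rewrite nth_rcons se ltnn eqxx => <- hd; split=> //.
  exists (nth [::] eta l); last first.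
    have := hd l.+1; rewrite leqnn => /(_ isT).
    by rewrite /= (e0 l _ se) // nth_rcons se ltnn eqxx.
  split=> //; first by move: h0; rewrite (e0 _ _ se).
  move=> k /andP[k0 kl]; rewrite -(e0 k.-1 _ se) -?(e0 k _ se); [|lia..].
  by apply: hd; lia.
subst nu; split; rewrite ?size_rcons ?se ?all_rcons ?pl //;
  first by rewrite (e0 _ _ se).
  by rewrite nth_rcons se ltnn eqxx.
move=> k /andP[k0 kl]; rewrite (e0 _ _ se); last by lia.
have [kl1|kl1] := leqP k l; first by rewrite (e0 _ _ se) //; apply: hd; lia.
have -> : k = l.+1 by lia.
by rewrite /= nth_rcons se ltnn eqxx hl.
Qed.

Lemma OT_succP lam l eta : OT lam l.+1 eta ->
  exists mu eta' p, [/\ eta = rcons eta' lam, is_partition lam, is_partition mu,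
    OT mu l eta' & differ_by mu lam p].
Proof.
case/lastP: eta => [[]//|eta nu] H.
have [e pl [mu om [p d]]] := (OT_rcons _ _ _ _).1 H; exists mu, eta, p;
  subst nu.
split=> //; have [se /(all_nthP [::]) pe _ <- _] := om; apply: pe.
by rewrite se.
Qed.

Lemma Omega_rcons lam l eta nu k : OT lam l eta -> k < l ->
  Omega (rcons eta nu) k.+1 = Omega eta k.+1.
Proof. by move=> [se _ _ _ _] kl;
  rewrite /Omega /= !nth_rcons se ltnS (ltnW kl) ltnS kl. Qed.

Lemma Omega_rcons_last lam l eta nu : OT lam l eta ->
  Omega (rcons eta nu) l.+1 = Delta lam nu.
Proof.
by move=> [se _ _ hl _]; rewrite /Omega /= !nth_rcons se ltnSn hl ltnn eqxx.
Qed.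

Local Notation asc := (ascents (fun m n : int => (m < n)%R)).

Lemma ascents_rcons prec lam l eta nu : OT lam l eta ->
  ascents prec (rcons eta nu) =
  ascents prec eta + ((0 < l) && prec (Omega eta l) (Delta lam nu)).
Proof.
move=> o; have [se _ _ hl _] := o; rewrite /ascents size_rcons se /=.
case: l o se hl => [//|l] o se hl; rewrite [_.-1]/=.
have -> : iota 1 l.+1 = iota 1 l ++ [:: l.+1] by have := iotaD 1 l 1;
  rewrite addn1 add1n.
rewrite count_cat /= addn0; congr (_ + _).
  apply: eq_in_count => -[|k]; rewrite mem_iota // => kl.
  by rewrite !(Omega_rcons _ o) //; lia.
by rewrite (Omega_rcons _ o) // (Omega_rcons_last _ o).
Qed.

Lemma ascents_le prec lam l eta : OT lam l.+1 eta -> ascents prec eta <= l.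
Proof.
by move=> [se _ _ _ _]; rewrite /ascents se -[leqRHS](size_iota 1) count_size.
Qed.

(** Each tableau is counted once for every way to cut it into [n] possibly empty blocks with
    increasing contents. *)
Definition OT_weight n lam l := \sum_(eta <- OT_enum lam l) 'C(n + asc eta, l).

(* The weight of [eta] counts its cuttings into [n.+1] blocks with increasing
   contents such that the contents in the last block are less than [c]. *)
Definition OT_weight_below n lam l (c : int) :=
  \sum_(eta <- OT_enum lam l)
    'C(n + asc eta + ((0 < l) && (Omega eta l < c)%R), l).

Lemma Omega_last lam mu l eta p : OT mu l eta -> differ_by mu lam p ->
  Omega (rcons eta lam) l.+1 = content p.
Proof. by move=> o d; rewrite (Omega_rcons_last _ o) (DeltaE d). Qed.

(** Raising the bound from [c] to [c + 1] affects only the tableaux with last content [c]. For these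
    the upper index of the binomial grows by one, and Pascal's rule gives the extra term. *)
Lemma OT_weight_below_step n lam l c : OT_weight_below n lam l.+1 (c + 1)%R =
  OT_weight_below n lam l.+1 c +
  \sum_(eta <- OT_enum lam l.+1 | Omega eta l.+1 == c) 'C(n + asc eta, l).
Proof.
rewrite /OT_weight_below [X in _ = _ + X]big_mkcond -big_split /=;
  apply: eq_bigr => eta _.
case: eqP => [->|ne]; last by rewrite addn0; congr 'C(_ + nat_of_bool _, _);
  lia.
have -> : (c < c + 1)%R by lia.
by rewrite Order.POrderTheory.ltxx addn1 addn0 binS.
Qed.

Lemma OT_weight_below_no_neighbour n lam l c :
  (forall mu p, is_partition mu -> differ_by mu lam p -> content p <> c) ->
  OT_weight_below n lam l (c + 1)%R = OT_weight_below n lam l c.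
Proof.
case: l => // l H;
  rewrite OT_weight_below_step big_seq_cond big_pred0 ?addn0 // => eta.
apply/negP => /andP[/mem_OT_enum /OT_succP[mu [eta' [p [-> pl pm o d]]]]].
by rewrite (Omega_last o d) => /eqP; exact: H d.
Qed.

(** The tableaux with last content [c] are those of [mu] followed by [lam]. The last step creates an
    ascent exactly when the content before it is less than [c], which is the correction term in the
    weight of [mu]. *)
Lemma OT_weight_below_neighbour n lam mu l c p : is_partition lam ->
  is_partition mu ->
  differ_by mu lam p -> content p = c ->
  OT_weight_below n lam l.+1 (c + 1)%R = OT_weight_below n lam l.+1 c +
    OT_weight_below n mu l c.
Proof.
move=> pl pm d cp; rewrite OT_weight_below_step; congr (_ + _);
  rewrite -big_filter.
have -> : \sum_(i <- [seq i <- OT_enum lam l.+1 | Omega i l.+1 == c]) 'C(n +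
  asc i, l) =
    \sum_(i <- [seq rcons eta lam | eta <- OT_enum mu l]) 'C(n + asc i, l).
  apply: perm_big; apply: uniq_perm.
  - by rewrite filter_uniq // uniq_OT_enum.
  - rewrite map_inj_uniq ?uniq_OT_enum // => x y.
    by move=> /(congr1 (rcons^~ lam)) /rcons_inj[/rcons_inj[]].
  move=> eta; rewrite mem_filter;
    apply/andP/mapP => [[/eqP e /mem_OT_enum]|[eta']].
    move=> /OT_succP[nu [eta' [q [h _ pn o dq]]]]; exists eta' => //;
      apply/mem_OT_enum.
    (* The last partition but one is forced to be [mu], the only neighbour of [lam] with content
       [c]. *)
    rewrite (differ_content_inj pl pm pn d dq) // cp -e h.
    by rewrite (Omega_last o dq).
  move=> /mem_OT_enum o ->; split; first by rewrite (Omega_last o d) cp.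
  by apply/mem_OT_enum/OT_rcons; split=> //; exists mu => //; exists p.
rewrite big_map /OT_weight_below big_seq [RHS]big_seq;
  apply: eq_bigr => eta /mem_OT_enum o.
by rewrite (ascents_rcons _ _ o) (DeltaE d) cp addnA.
Qed.

Lemma size_differ mu lam p : is_partition mu -> is_partition lam ->
  differ_by mu lam p -> size lam <= size mu \/
  size lam = (size mu).+1 /\ content p = (1 - Posz (size lam))%R.
Proof.
case: p => i j pm pl d; have [sl|sl] := leqP (size lam) (size mu);
  first by left.
right; have := part_gt_size pl (ltn0Sn (size mu)).
have := part_gt_size pl (ltn0Sn (size mu).+1).
have := part_gt_size pm (ltn0Sn (size mu)).
have := part_gt_size pm (ltn0Sn (size mu).+1).
rewrite sl ltnn ltnNge leqnSn /= => m2 m1 l2 l1.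
case: d => /adds_squareP[i0 e1 e2 e3].
  have ii : i = (size mu).+1.
    by apply/eqP; apply: contraT => /eqP ne; have := e3 (size mu).+1 isT; lia.
  subst i; have := e3 (size mu).+2 isT; rewrite /content /=; lia.
case: (eqVneq i (size mu).+1) => [|/eqP] ii; first by subst i; lia.
have := e3 (size mu).+1 isT; lia.
Qed.

(** The extreme case is a new row: the square in row [(size lam).+1] and column 1. *)
Lemma content_ge mu lam p : is_partition mu -> is_partition lam ->
  differ_by mu lam p -> (- Posz (size lam) <= content p)%R.
Proof.
case: p => i j pm pl [] /adds_squareP[i0 e1 e2 e3]; rewrite /content /=.
  by have := part_gt_size pl i0; lia.
have [i1|i1] := leqP i 1; first by lia.
have i2 : 0 < i.-1 by lia.
have := part_gt_size pl i2; have := e3 i.-1 i2;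
  have := @part_mono mu i.-1 i pm i2.
lia.
Qed.

Lemma content_le mu lam p : is_partition lam ->
  differ_by mu lam p -> (content p <= Posz (part lam 1))%R.
Proof.
case: p => i j pl [] /adds_squareP[i0 e1 e2 e3]; rewrite /content /=;
  by have := @part_mono lam 1 i pl isT i0; lia.
Qed.

Lemma OT0 lam eta : OT lam 0 eta <-> lam = [::] /\ eta = [:: [::]].
Proof.
split=> [[]|[-> ->]]; last by split=> //= k; case: k.
by case: eta => [|x []] //= _ _ -> ->.
Qed.

(* A block with increasing contents adds at most one new row, and
   [l - asc eta] is the least number of blocks. *)
Lemma size_add_ascents lam l eta : OT lam l eta -> size lam + asc eta <= l /\
  (0 < l -> size lam + asc eta = l -> (1 - Posz (size lam) <= Omega eta l)%R).
Proof.
elim: l lam eta => [|l IH] lam eta; first by move=> /OT0[-> ->].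
move=> /OT_succP[mu [eta' [p [-> pl pm o d]]]].
have := IH _ _ o; rewrite (ascents_rcons _ _ o) (Omega_last o d) (DeltaE d).
have := size_differ pm pl d; set c := content p.
case: l o {IH} => [|l] o /=; last by case: Order.TotalTheory.ltP => /=; lia.
by move: o => /OT0[-> ->] /=; lia.
Qed.

Lemma OT_weight0 l : OT_weight 0 [::] l = (l == 0).
Proof.
case: l => [|l]; rewrite /OT_weight.
  rewrite (perm_big [:: [:: [::]]]) ?big_seq1 //; apply: uniq_perm => //.
    exact: uniq_OT_enum.
  move=> eta; rewrite inE; apply/idP/eqP => [/mem_OT_enum/OT0[]//|->].
  by apply/mem_OT_enum/OT0.
rewrite big_seq big1 // => eta /mem_OT_enum o; apply: bin_small.
by have := ascents_le (fun m n : int => (m < n)%R) o; lia.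
Qed.

(** If [lam] has at most [n] rows, no last content lies below [- n], so the last block is empty. If
    it has more, then by [size_add_ascents] the blocks are too few and every binomial vanishes. *)
Lemma OT_weight_below_bottom n lam l :
  OT_weight_below n lam l (- Posz n)%R = if size lam <= n then OT_weight n lam
    l else 0.
Proof.
rewrite /OT_weight_below /OT_weight; case: ifP => sn; last first.
  rewrite big_seq big1 // => eta /mem_OT_enum o; apply: bin_small.
  have := size_add_ascents o; case: l o => [/OT0[e _]|l o].
    by move: sn; rewrite e.
  by case: Order.TotalTheory.ltP => /=; lia.
rewrite big_seq [RHS]big_seq; apply: eq_bigr => eta /mem_OT_enum.
case: l => [|l] o; first by rewrite !bin0.
have [mu [eta' [p [-> pl pm o' d]]]] := OT_succP o.
have := content_ge pm pl d; rewrite (Omega_last o' d).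
by case: Order.TotalTheory.ltP => /= h; rewrite ?addn0 //; lia.
Qed.

(** No last content exceeds the first part, so the bound does not restrict the last of the [n.+1]
    blocks. *)
Lemma OT_weight_below_top n lam l c : (Posz (part lam 1) < c)%R ->
  OT_weight_below n lam l c = OT_weight n.+1 lam l.
Proof.
move=> hc; rewrite /OT_weight_below /OT_weight big_seq [RHS]big_seq;
  apply: eq_bigr => eta /mem_OT_enum.
case: l => [|l] o; first by rewrite !bin0.
have [mu [eta' [p [-> pl pm o' d]]]] := OT_succP o.
have := content_le pl d; rewrite (Omega_last o' d).
by case: Order.TotalTheory.ltP => /= h; [rewrite addn1 addSn | lia].
Qed.

(** * Scanning one row of the lattice *)

(* All ways to fill one row of the square lattice, from right to left.  The word
   [u] tells which bottom edges are occupied and [q] says whether the right edge is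
   empty; the result pairs the word of the occupied top edges with the number of
   vacancies and osculations in the row, provided the left edge is empty. *)
Fixpoint row_scan (q : bool) (u : seq bool) : seq (seq bool * nat) :=
  if u is p :: u' then
    [seq (q :: x.1, x.2) | x <- row_scan p u'] ++
    (if p != q then [seq (p :: x.1, x.2.+1) | x <- row_scan q u'] else [::])
  else if q then [:: ([::], 0)] else [::].

(** The invariant in the middle of a row: [x] holds the top edges already chosen, [q] the horizontal
    edge at the cut, [y] the bottom edges still to be scanned. Passing a column either keeps the
    boundary word [x ++ q :: y] or swaps two of its letters, and a swap changes the shape by a
    square of content [size y - n], with [y] the letters left after the swap. These choices are the
    two terms of [OT_weight_below_neighbour]. *)
Lemma OT_weight_below_row_scan n x q y l : count id (x ++ q :: y) = n.+1 ->
  OT_weight_below n (shape (x ++ q :: y)) l (Posz (size y) - Posz n)%R =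
  \sum_(z <- row_scan q y | z.2 <= l) OT_weight n (shape (x ++ z.1)) (l - z.2).
Proof.
elim: y x q l => [|p y IH] x q l.
  move=> cn; have -> : (Posz (size (@nil bool)) - Posz n = - Posz n)%R by
    rewrite /=; lia.
  (* For [q = false] all [n.+1] rows of the shape are nonzero and the weight is 0; for [q = true]
     the final letter adds an empty row, leaving at most [n] rows. *)
  rewrite OT_weight_below_bottom; move: cn; rewrite count_cat /=;
    case: q => /= cn; last first.
    rewrite big_nil ifF // /shape rows_cat /= cats0.
    rewrite (@eq_in_filter _ _ predT) ?filter_predT ?size_map ?size_rows;
      first by lia.
    by move=> _ /mapP[r _ ->] /=; lia.
  have -> : shape (x ++ [:: true]) = shape x.
    rewrite /shape rows_cat /= filter_cat /= cats0.
    by rewrite (@eq_map _ _ _ id) ?map_id // => r; rewrite !addn0.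
  rewrite big_cons big_nil /= cats0 subn0 addn0 ifT //.
  by rewrite size_filter (leq_trans (count_size _ _)) // size_rows; lia.
move=> cn; rewrite [size _]/=.
have -> : (Posz (size y).+1 - Posz n = Posz (size y) - Posz n + 1)%R by lia.
have IHq := IH (rcons x q) p; have IHp := IH (rcons x p) q.
rewrite !cat_rcons in IHq IHp.
(* The branch with a single path through the point: the boundary word is only regrouped. *)
have eq1 k : \sum_(z <- [seq (q :: x0.1, x0.2) | x0 <- row_scan p y] | z.2 <= k)
     OT_weight n (shape (x ++ z.1)) (k - z.2) = OT_weight_below n (shape (x ++
       q :: p :: y)) k (Posz (size y) - Posz n)%R.
  by rewrite IHq // big_map /=; apply: eq_bigr => z _; rewrite cat_rcons.
rewrite /= big_cat eq1 /=; case: eqP => [pq|/eqP pq] /=.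
  subst q; rewrite big_nil addn0;
    apply: OT_weight_below_no_neighbour => mu d pm dm.
  have := shape_no_swap pm dm; rewrite cn; lia.
(* The letters differ, so a vacancy or an osculation is possible: the letters [q] and [p] are
   swapped and one step is used up. *)
have cnp : count id (x ++ p :: q :: y) = n.+1.
  by rewrite -cn !count_cat /=; lia.
case: l => [|l].
  rewrite big_map big_pred0 // addn0 /OT_weight_below.
  by apply: eq_bigr => eta _; rewrite !bin0.
rewrite (OT_weight_below_neighbour (mu := shape (x ++ p :: q :: y)) _ _ _ _
  (shape_swap x y pq));
  rewrite ?is_partition_shape //; last first.
  have := count_negb y; move: cn; rewrite count_cat /content /=.
  by move: pq; case: (p); case: (q) => //=; lia.
congr (_ + _); rewrite IHp // big_map /=; apply: eq_bigr => z _.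
by rewrite cat_rcons subSS.
Qed.

(** A full row starts with an occupied right edge, that is [q = false]. This leading letter leaves
    the shape unchanged, and the first bound [size u - n] exceeds the first part. *)
Lemma OT_weight_row_scan n u l : count id u = n.+1 ->
  OT_weight n.+1 (shape u) l = \sum_(z <- row_scan false u | z.2 <= l)
    OT_weight n (shape z.1) (l - z.2).
Proof.
move=> cn; have := @OT_weight_below_row_scan n [::] false u l;
  rewrite /= add0n => <- //.
rewrite (_ : shape (false :: u) = shape u) // OT_weight_below_top // part_shape.
have : nth 0 (rows u) 0 <= count negb u.
  have := rows_le u; case: (rows u) => //= r s /andP[].
  by [].
by rewrite -[1.-1]/0; have := count_negb u; lia.
Qed.

(** * Peeling off the bottom row *)

Lemma mem_onth (T : eqType) (s : seq T) x :
  (x \in s) <-> exists m, onth s m = Some x.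
Proof.
elim: s => [|y s IH]; first by split=> // -[m]; rewrite onth0n.
rewrite inE; split=> [/orP[/eqP->|/IH[m e]]|[[[->]|m /= e]]]; first by exists 0.
- by exists m.+1.
- by rewrite eqxx.
- by apply/orP; right; apply/IH; exists m.
Qed.

(** Each step raises column minus row by one, so a point of a path determines its index. *)
Lemma path_step_onth p Q m i j : path step p Q -> onth (p :: Q) m = Some (i, j)
  ->
  m + p.2 + i = p.1 + j.
Proof.
elim: Q p m => [|q Q IH] p [|m] /=; rewrite ?onth0n //;
  try by move=> _ [->] /=; lia.
move=> /andP[st pQ] /(IH q m pQ); case/orP: st => /eqP ->/=; lia.
Qed.

Lemma path_step_mem p Q x b i j : path step p Q -> last p Q = (x, b) ->
  (i, j) \in p :: Q -> [/\ x <= i, i <= p.1, p.2 <= j & j <= b].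
Proof.
elim: Q p i j => [|q Q IH] [p1 p2] i j /=.
  by move=> _ [-> ->]; rewrite inE => /eqP[-> ->].
case: q => q1 q2; rewrite /step => /andP[st pQ] lQ.
have := IH _ q1 q2 pQ lQ (mem_head _ _).
move=> /= [? ? ? ?];
  rewrite inE => /orP[/eqP[-> ->]|/(IH _ _ _ pQ lQ) /= [? ? ? ?]];
  by case/orP: st => /eqP[? ?]; split; lia.
Qed.

Section PathFacts.
Context (a b x y : nat) (Q : seq (nat * nat)) (pQ : paths a b x y Q).

Lemma paths_index m i j : onth Q m = Some (i, j) -> m + y + i = a + j.
Proof. by case: pQ => Q' [-> sQ _] /(path_step_onth sQ). Qed.

Lemma paths_mem i j : (i, j) \in Q -> [/\ x <= i, i <= a, y <= j & j <= b].
Proof. by case: pQ => Q' [-> sQ lQ] /(path_step_mem sQ lQ). Qed.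

Lemma paths_onth m i j : onth Q m = Some (i, j) -> (i, j) \in Q.
Proof. by move=> e; apply/mem_onth; exists m. Qed.

Lemma paths_mem_onth i j m : (i, j) \in Q -> m + y + i = a + j ->
  onth Q m = Some (i, j).
Proof.
move=> /mem_onth[k ek] em; have := paths_index ek => ?.
by have -> : m = k by lia.
Qed.

Lemma paths_start : onth Q 0 = Some (a, y).
Proof. by case: pQ => Q' [->]. Qed.

Lemma paths_end : onth Q (size Q).-1 = Some (x, b).
Proof.
case: pQ => Q' [-> _ lQ]; rewrite /= -lQ (last_nth (a, y)).
by rewrite onthE (nth_map (a, y)).
Qed.

Lemma paths_start_mem : (a, y) \in Q.
Proof. exact: paths_onth paths_start. Qed.

Lemma paths_le : x <= a /\ y <= b.
Proof. by have [] := paths_mem paths_start_mem. Qed.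

End PathFacts.

(* [osculating Q R] in terms of the points of the paths only, for a lower path
   [R] from [(a, y)] to [(x, b)]. *)
Definition osc (a b x y : nat) (Q R : seq (nat * nat)) : Prop :=
  forall i j, (i, j) \in Q -> (i, j) \in R ->
  [/\ 0 < j /\ (i, j.-1) \in Q, 0 < i /\ (i.-1, j) \in Q,
      (i, j) <> (a, y) -> (i.+1, j) \in R &
      (i, j) <> (x, b) -> (i, j.+1) \in R].

(** Since a point determines its index on a path, membership of a neighbouring point amounts to its
    being the previous or the next one. *)
Lemma osculatingP a b x y x' y' Q R : paths a b x y Q -> paths a b x' y' R ->
  osculating Q R <-> osc a b x' y' Q R.
Proof.
move=> pQ pR; split=> [H i j iQ iR|H m m' i j em em'].
  have [[m em] [m' em']] := ((mem_onth _ _).1 iQ, (mem_onth _ _).1 iR).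
  have [[m0 h1] h2 h3 h4] := H _ _ _ _ em em'.
  have i0 := paths_index pQ em; have i0' := paths_index pR em'.
  have i1 := paths_index pQ h1; have i2 := paths_index pQ h2.
  have i3 := paths_mem pQ iQ; split.
  - by split; [lia | exact: paths_onth h1].
  - by split; [lia | exact: paths_onth h2].
  - move=> ne; suff /h3/paths_onth : m' <> 0 by [].
    by move=> m'0; apply: ne; move: em';
      rewrite m'0 (paths_start pR) => -[-> ->].
  - move=> ne; suff /h4/paths_onth : m'.+1 <> size R by [].
    by move=> m'0; apply: ne; move: (paths_end pR);
      rewrite -m'0 em' => -[-> ->].
have [iQ iR] := (paths_onth em, paths_onth em').
have i0 := paths_index pQ em; have i0' := paths_index pR em'.
have [[j0 h1] [i1 h2] h3 h4] := H _ _ iQ iR.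
have [_ ia yj _] := paths_mem pQ h1.
split.
- by split; [lia | apply: (paths_mem_onth pQ) => //; lia].
- by apply: (paths_mem_onth pQ) => //; lia.
- move=> m0; apply: (paths_mem_onth pR); last by lia.
  by apply: h3 => -[]; lia.
rewrite -[@size _ R]/(@size (nat * nat) R) => m0; apply: (paths_mem_onth pR);
  last by lia.
apply: h4 => -[]; have := paths_index pR (paths_end pR).
have : m' < @size (nat * nat) R by rewrite -onthTE em'.
by lia.
Qed.

Definition row_segment (i y d : nat) : seq (nat * nat) :=
  [seq (i, j) | j <- iota y (d.+1 - y)].

Lemma mem_row_segment i y d k j : ((k, j) \in row_segment i y d) = [&& k == i,
  y <= j & j <= d].
Proof.
apply/mapP/idP => [[j' + [-> ->]]|/and3P[/eqP-> yj jd]].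
  by rewrite mem_iota eqxx => ?; apply/andP; split; lia.
by exists j => //; rewrite mem_iota; lia.
Qed.

Lemma row_segment_cons i y d : y <= d -> row_segment i y d = (i, y) ::
  row_segment i y.+1 d.
Proof. by move=> yd; rewrite /row_segment subSn // [d.+1 - y.+1]subSS. Qed.

Lemma path_row_segment i y d : y <= d ->
  [/\ path step (i, y) (behead (row_segment i y d)), last (i, y) (behead
    (row_segment i y d)) = (i, d) &
      row_segment i y d = (i, y) :: behead (row_segment i y d)].
Proof.
move=> yd; rewrite row_segment_cons // -(subnKC yd); move: (d - y) => n {yd} /=.
split=> //; elim: n y => [|n IH] y; rewrite ?addn0 /=.
- by rewrite /row_segment subnn.
- rewrite row_segment_cons; last by lia.
  by rewrite /= /step eqxx /= -addSnnS IH.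
- by rewrite /row_segment subnn.
- rewrite row_segment_cons; last by lia.
  by rewrite /= -addSnnS IH.
Qed.

Lemma paths_row_segment a b y : y <= b -> paths a b a y (row_segment a y b).
Proof. by move=> yb; have [p l e] := path_row_segment a yb; rewrite e;
  exists (behead (row_segment a y b)). Qed.

Lemma paths_cat a b x y d Q : y <= d -> paths a b x d Q ->
  paths a.+1 b x y (row_segment a.+1 y d ++ Q).
Proof.
move=> yd [Q' [-> pQ lQ]]; have [p l e] := path_row_segment a.+1 yd.
exists (behead (row_segment a.+1 y d) ++ (a, d) :: Q'); rewrite e; split=> //=.
  by rewrite cat_path p /= pQ andbT l /step /= eqxx orbT.
by rewrite last_cat /= lQ.
Qed.

Lemma paths_top a b y Q : paths a b a y Q -> y <= b /\ Q = row_segment a y b.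
Proof.
move=> pQ; have [_ yb] := paths_le pQ; split=> //.
move: pQ => [Q' [-> + +]] {Q}; elim: Q' y yb => [|q Q' IH] y yb.
  by move=> _ [<-]; rewrite row_segment_cons ?leqnn // /row_segment subnn.
move=> /= /andP[st pQ] lQ; rewrite row_segment_cons //; congr cons.
case/orP: st => /eqP e; subst; last first.
  have := @path_step_mem _ _ _ _ q.1 q.2 pQ lQ.
  by rewrite -surjective_pairing inE eqxx;
    case: q e {pQ lQ} => ? ? [->] /= _ /(_ isT)[]; lia.
have [_ _ yb' _] := path_step_mem pQ lQ (mem_head _ _).
by rewrite IH //=; have [_ _ _] := path_step_mem pQ lQ (mem_head _ _).
Qed.

(** * Cutting one or two paths above the bottom row *)

Definition upper (a : nat) (Q : seq (nat * nat)) : seq (nat * nat) :=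
  [seq p <- Q | p.1 <= a].

Lemma upper_cons a p Q :
  upper a (p :: Q) = if p.1 <= a then p :: upper a Q else upper a Q.
Proof. by []. Qed.

(** Rows never increase along a path, so it leaves the bottom row once, upwards in a column [d]. *)
Lemma paths_split a b x y Q : x <= a -> paths a.+1 b x y Q ->
  exists d, [/\ y <= d, paths a b x d (upper a Q) & Q = row_segment a.+1 y d ++
    upper a Q].
Proof.
move=> xa [Q' [-> + +]] {Q}; elim: Q' y => [|q Q' IH] y.
  by move=> _ []; lia.
move=> /= /andP[st pQ] lQ; case/orP: st => /eqP /= e; subst.
  have [d [yd pd ed]] := IH _ pQ lQ; exists d.
  rewrite !upper_cons ?ltnn /= in pd ed *; split=> //; first by lia.
  by rewrite row_segment_cons /= -?ed //; lia.
case: q e pQ lQ => q1 q2 /= [<- <-] pQ lQ; exists y; split=> //.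
  rewrite /upper /= ltnn leqnn; exists Q'; split=> //.
  congr cons; apply/all_filterP/allP => -[i j] ijQ.
  by have [] := path_step_mem pQ lQ (_ : (i, j) \in _); rewrite ?inE ?ijQ ?orbT.
rewrite row_segment_cons // /row_segment subnn /= /upper /= ltnn leqnn;
  do 2 congr cons.
apply/esym/all_filterP/allP => -[i j] ijQ.
by have [] := path_step_mem pQ lQ (_ : (i, j) \in _); rewrite ?inE ?ijQ ?orbT.
Qed.

(** The bottom segments may share only the point in column [d = y'], where [Q] turns up and the
    lower path starts. If [d > y'], the first path could not go up at column [y']; if [d = d'], then
    [d = y'] and the lower path could not go right there. *)
Lemma osc_cat a b x x' y d Q y' d' R :
  paths a b x d Q -> paths a b x' d' R -> y <= d -> y < y' -> y' <= d' ->
  osc a.+1 b x' y' (row_segment a.+1 y d ++ Q) (row_segment a.+1 y' d' ++ R) <->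
  [/\ d <= y', d < d' & osc a b x' d' Q R].
Proof.
move=> pQ pR yd yy yd'; have [[xa db] [xa' db']] := (paths_le pQ, paths_le pR).
have memQ i j : (i, j) \in Q -> i <= a /\ d <= j by move=> /(paths_mem pQ)[].
have memR i j : (i, j) \in R -> i <= a /\ d' <= j by move=> /(paths_mem pR)[].
split=> [H|[dy dd H] i j].
  have dy : d <= y'.
    rewrite leqNgt; apply/negP => yd1; have [||_ [_ up] _ _] := H a.+1 y'.
    - by rewrite mem_cat mem_row_segment eqxx /= ltnW // ltnW.
    - by rewrite mem_cat mem_row_segment eqxx leqnn yd'.
    - by move: up; rewrite mem_cat mem_row_segment ltn_eqF //= => /memQ[]; lia.
  have dd : d < d'.
    rewrite ltnNge; apply/negP => dd; have e : d = d' by lia.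
    have e' : d = y' by lia.
    have [||_ _ _ right] := H a.+1 y'.
    - by rewrite mem_cat mem_row_segment eqxx /= -e' yd leqnn.
    - by rewrite mem_cat mem_row_segment eqxx leqnn yd'.
    - have /right : (a.+1, y') <> (x', b) by case; lia.
      by rewrite mem_cat mem_row_segment => /orP[/and3P[]|/memR[]]; lia.
  split=> // i j iQ iR; have [[ia dj] [_ dj']] := (memQ _ _ iQ, memR _ _ iR).
  have [||[j0 h1] [i0 h2] h3 h4] := H i j; rewrite ?mem_cat ?iQ ?iR ?orbT //.
  rewrite !mem_cat !mem_row_segment in h1 h2 h3 h4; split.
  - by split=> //; case/orP: h1 => // /and3P[/eqP]; lia.
  - by split=> //; case/orP: h2 => // /and3P[/eqP]; lia.
  - move=> ne; have /h3/orP[/and3P[/eqP [e] _ jd]|//] : (i, j) <> (a.+1, y').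
      by case; lia.
    by case: ne; congr pair; lia.
  - by move=> ne; have /orP[/and3P[/eqP]|//] := h4 ne; lia.
rewrite !mem_cat !mem_row_segment => /orP[/and3P[/eqP-> yj jd]|iQ].
  move=> /orP[/and3P[_ yj' jd']|/memR]; last by lia.
  have ej : j = d by lia.
  have ey : j = y' by lia.
  split; last 1 first.
  - by move=> _; rewrite eqxx; apply/orP; left; lia.
  - by split; [lia|apply/orP; left; rewrite eqxx; lia].
  - by split=> //; rewrite ej (paths_start_mem pQ) orbT.
  - by rewrite ey.
have [ia dj] := memQ _ _ iQ; move=> /orP[/and3P[/eqP]|iR]; first by lia.
have [_ dj'] := memR _ _ iR; have [[j0 h1] [i0 h2] h3 h4] := H _ _ iQ iR.
rewrite h1 h2 !orbT; split=> //; last by move=> /h4 ->; rewrite orbT.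
(* At the start [(a, d')] of [R] the point required below it is the end of its bottom segment. *)
move=> _; have [e|/eqP/h3 ->] := eqVneq (i, j) (a, d'); last by rewrite orbT.
by move: e => [-> ->]; rewrite eqxx yd' leqnn.
Qed.

Lemma osc_last a b x y d Q y' :
  paths a b x d Q -> y <= d -> y < y' -> y' <= b ->
  osc a.+1 b a.+1 y' (row_segment a.+1 y d ++ Q) (row_segment a.+1 y' b) <-> d
    <= y'.
Proof.
move=> pQ yd yy yb; have [xa db] := paths_le pQ.
have memQ i j : (i, j) \in Q -> i <= a /\ d <= j by move=> /(paths_mem pQ)[].
split=> [H|dy i j].
  rewrite leqNgt; apply/negP => yd1; have [||_ [_ up] _ _] := H a.+1 y'.
  - by rewrite mem_cat mem_row_segment eqxx /= ltnW // ltnW.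
  - by rewrite mem_row_segment eqxx leqnn yb.
  - by move: up; rewrite mem_cat mem_row_segment ltn_eqF //= => /memQ[]; lia.
rewrite !mem_cat !mem_row_segment => /orP[/and3P[/eqP-> yj jd]|/memQ[ia _]];
  last first.
  by move=> /and3P[/eqP]; lia.
move=> /and3P[_ yj' jb]; have ej : j = d by lia.
have ey : j = y' by lia.
split.
- by split; [lia|apply/orP; left; rewrite eqxx; lia].
- by split=> //; rewrite ej (paths_start_mem pQ) orbT.
- by rewrite ey.
- by move=> ne; rewrite eqxx; apply/and3P; split=> //;
    [lia | case: (eqVneq j b) => [e|]; [case: ne; rewrite e | lia]].
Qed.

(** * Removing and restoring the bottom row of a path tuple *)

Definition OP_seq a b (xs ys : seq nat) (P : seq (seq (nat * nat))) : Prop :=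
  [/\ size P = size xs,
      forall k, k < size xs -> paths a b (nth 0 xs k) (nth 0 ys k) (nth [::] P
        k) &
      forall k, k.+1 < size xs ->
        osc a b (nth 0 xs k.+1) (nth 0 ys k.+1) (nth [::] P k) (nth [::] P
          k.+1)].

Definition interlacing (n : nat) (ys ds : seq nat) : Prop :=
  (forall k, k < n -> nth 0 ys k <= nth 0 ds k <= nth 0 ys k.+1) /\
  (forall k, k.+1 < n -> nth 0 ds k < nth 0 ds k.+1).

(** The defaults describe the last path: index [n] is past the end of [ds] and [P], so this path
    runs along the bottom row to column [b] and has no upper part. *)
Definition add_row (n b : nat) (ys ds : seq nat) (P : seq (seq (nat * nat))) :=
  mkseq (fun k => row_segment n.+1 (nth 0 ys k) (nth b ds k) ++ nth [::] P k)
    n.+1.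

Lemma OP_seq_add_row n b ys ds P :
  size ys = n.+1 -> (forall k, k < n -> nth 0 ys k < nth 0 ys k.+1) ->
  nth 0 ys n <= b -> size ds = n -> interlacing n ys ds ->
  OP_seq n b (iota 1 n) ds P -> OP_seq n.+1 b (iota 1 n.+1) ys (add_row n b ys
    ds P).
Proof.
move=> sy incy yb sd [yd incd] [sP pP oP]; rewrite size_iota in sP pP oP.
have nd k : k < n -> nth b ds k = nth 0 ds k.
  by move=> kn; apply: set_nth_default; rewrite sd.
have top : nth [::] (add_row n b ys ds P) n = row_segment n.+1 (nth 0 ys n) b.
  by rewrite nth_mkseq // [nth b ds n]nth_default ?sd // [nth [::] P
    n]nth_default ?sP // cats0.
have low k : k < n -> nth [::] (add_row n b ys ds P) k =
    row_segment n.+1 (nth 0 ys k) (nth 0 ds k) ++ nth [::] P k.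
  by move=> kn; rewrite nth_mkseq ?nd // ltnS ltnW.
have pk k : k < n -> paths n b k.+1 (nth 0 ds k) (nth [::] P k).
  by move=> kn; have := pP k kn; rewrite nth_iota.
split; first by rewrite size_mkseq size_iota.
  move=> k; rewrite size_iota ltnS => kn; rewrite nth_iota // add1n.
  move: kn; rewrite leq_eqVlt => /orP[/eqP->|kn].
    by rewrite top; exact: paths_row_segment.
  by rewrite low //; apply: paths_cat (pk k kn); have /andP[] := yd k kn.
move=> k; rewrite size_iota ltnS => kn; rewrite nth_iota // add1n low //.
have /andP[yk ky] := yd k kn.
move: (kn); rewrite leq_eqVlt => /orP[/eqP e|kn1].
  rewrite e top; apply/(osc_last (pk k kn)); rewrite -?e //; first exact: incy.
  by rewrite e.
rewrite low //; have /andP[yk1 _] := yd _ kn1.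
apply/(osc_cat (pk _ kn) (pk _ kn1)); rewrite ?incy //; split=> //;
  first exact: incd.
by have := oP k kn1; rewrite nth_iota.
Qed.

Lemma OP_seq_split n b ys P :
  size ys = n.+1 -> (forall k, k < n -> nth 0 ys k < nth 0 ys k.+1) ->
  OP_seq n.+1 b (iota 1 n.+1) ys P ->
  exists ds P', [/\ size ds = n, interlacing n ys ds, OP_seq n b (iota 1 n) ds
    P' &
    P = add_row n b ys ds P'].
Proof.
move=> sy incy [sP pP oP]; rewrite size_iota in sP pP oP.
pose P' := mkseq (fun k => upper n (nth [::] P k)) n.
(* A path leaves the bottom row in the column where its truncation starts. *)
pose ds := mkseq (fun k => (head (0, 0) (nth [::] P' k)).2) n.
have sp k : k < n -> [/\ nth 0 ys k <= nth 0 ds k,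
    paths n b k.+1 (nth 0 ds k) (nth [::] P' k) &
    nth [::] P k = row_segment n.+1 (nth 0 ys k) (nth 0 ds k) ++ nth [::] P' k].
  move=> kn; have := pP k (ltnW kn); rewrite nth_iota ?add1n; last exact: ltnW.
  move=> /paths_split -/(_ kn)[d].
  have -> : upper n (nth [::] P k) = nth [::] P' k by rewrite nth_mkseq.
  case=> yd pd e; suff -> : nth 0 ds k = d by [].
  by rewrite nth_mkseq //; case: pd => ? [->].
have top : nth 0 ys n <= b /\ nth [::] P n = row_segment n.+1 (nth 0 ys n) b.
  by apply: paths_top; have := pP n (ltnSn n); rewrite nth_iota.
have [topb topP] := top.
have os k : k < n -> nth 0 ds k <= nth 0 ys k.+1 /\ (k.+1 < n ->
    nth 0 ds k < nth 0 ds k.+1 /\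
    osc n b k.+2 (nth 0 ds k.+1) (nth [::] P' k) (nth [::] P' k.+1)).
  move=> kn; have [yk pk ek] := sp k kn; have := oP k kn;
    rewrite nth_iota // add1n ek.
  move: (kn); rewrite leq_eqVlt => /orP[/eqP e|kn1].
    rewrite e topP => /(osc_last pk) H; split; last by rewrite ltnn.
    by apply: H => //; rewrite -e incy.
  have [yk1 pk1 ek1] := sp _ kn1; rewrite ek1.
  by move=> /(osc_cat pk pk1) -/(_ yk (incy _ kn) yk1)[].
exists ds, P'; split; first by rewrite size_mkseq.
- split=> k kn; first by have [-> _ _] := sp k kn; have [-> _] := os k kn.
  by have [_ /(_ kn)[]] := os k (ltnW kn).
- split; rewrite ?size_iota ?size_mkseq // => k kn.
    by rewrite nth_iota //; have [] := sp k kn.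
  by rewrite nth_iota //; have [_ /(_ kn)[]] := os k (ltnW kn).
apply: (@eq_from_nth _ [::]); first by rewrite size_mkseq sP.
move=> k; rewrite sP ltnS leq_eqVlt => /orP[/eqP->|kn].
  by rewrite topP nth_mkseq // [nth b ds n]nth_default ?size_mkseq // [nth [::]
    P' n]nth_default ?size_mkseq // cats0.
rewrite nth_mkseq; last by rewrite ltnS ltnW.
have [_ _ ->] := sp k kn; congr (row_segment _ _ _ ++ _).
by apply: set_nth_default; rewrite size_mkseq.
Qed.

(** * Counting vacancies and osculations row by row *)

Definition two_or_none (m : nat) : bool := (m == 0) || (m == 2).

Definition crossings (P : seq (seq (nat * nat))) (i j : nat) : nat :=
  count (fun Q => (i, j) \in Q) P.

Definition Z_count (a b : nat) (P : seq (seq (nat * nat))) : nat :=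
  \sum_(i < a) \sum_(j < b) two_or_none (crossings P i.+1 j.+1).

Lemma count_nth (T : Type) (x0 : T) (p : pred T) s :
  count p s = \sum_(k < size s) p (nth x0 s k).
Proof.
elim: s => [|x s IH]; first by rewrite big_ord0.
by rewrite big_ord_recl /= IH.
Qed.

Lemma crossings_sum n P i j : size P = n ->
  crossings P i j = \sum_(k < n) ((i, j) \in nth [::] P k).
Proof. by move=> <-; exact: count_nth. Qed.

Lemma crossings_add_row_upper n b ys ds P i j : size P = n -> i <= n ->
  crossings (add_row n b ys ds P) i j = crossings P i j.
Proof.
move=> sP iN;
  rewrite (crossings_sum _ _ (size_mkseq _ _)) (crossings_sum _ _ sP).
have e (k : 'I_n.+1) : (i, j) \in nth [::] (add_row n b ys ds P) k = ((i, j)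
  \in nth [::] P k).
  by rewrite nth_mkseq // mem_cat mem_row_segment ltn_eqF.
rewrite (eq_bigr _ (fun k _ => congr1 nat_of_bool (e k))) big_ord_recr /=.
by rewrite (nth_default _ (_ : size P <= n)) ?sP // addn0.
Qed.

(** Path [k] meets column [j] of the bottom row when its start column is at most [j] and its exit
    column at least [j], so the number of such paths is a difference of counts, stated
    additively. *)
Lemma crossings_add_row n b ys ds P j :
  OP_seq n b (iota 1 n) ds P -> size ys = n.+1 -> size ds = n -> interlacing n
    ys ds ->
  j <= b ->
  crossings (add_row n b ys ds P) n.+1 j + count (fun d => d < j) ds =
  count (fun y => y <= j) ys.
Proof.
move=> [sP pP _] sy sd [yd _] jb; rewrite size_iota in sP pP.
rewrite (crossings_sum _ _ (size_mkseq _ _)) (count_nth 0) (count_nth 0) sy sd.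
rewrite !big_ord_recr /= -addnA [_ + \sum_(_ < _) _]addnC addnA -big_split /=.
congr (_ + _); last first.
  by rewrite nth_mkseq // [nth b ds n]nth_default ?sd // [nth [::] P
    n]nth_default ?sP // cats0 mem_row_segment eqxx jb andbT.
apply: eq_bigr => k _; rewrite nth_mkseq ?ltnS ?(ltnW (ltn_ord k)) //.
rewrite (set_nth_default 0) ?sd // mem_cat mem_row_segment eqxx /=.
have /negbTE -> : (n.+1, j) \notin nth [::] P k.
  by apply/negP => /(paths_mem (pP k (ltn_ord k))) []; rewrite ltnn.
have := yd k (ltn_ord k); rewrite orbF; lia.
Qed.

(** * Rows as words *)

(* The columns of the [true] letters; the head letter is in column [size u]. *)
Fixpoint pos (u : seq bool) : seq nat :=
  if u is p :: u' then
    if p then rcons (pos u') (size u').+1 else pos u'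
  else [::].

Fixpoint word (b : nat) (s : seq nat) : seq bool :=
  if b is b'.+1 then (b \in s) :: word b' s else [::].

Definition count_le (m : nat) (s : seq nat) : nat := count (fun x => x <= m) s.

Lemma size_pos u : size (pos u) = count id u.
Proof. by elim: u => //= -[] u /= IH; rewrite ?size_rcons IH. Qed.

Lemma pos_range u : all (fun x => 0 < x <= size u) (pos u).
Proof.
elim: u => //= -[] u IH; rewrite ?all_rcons /= ?leqnn //=;
  apply: sub_all IH => x /=; lia.
Qed.

Lemma sorted_pos u : sorted ltn (pos u).
Proof.
elim: u => //= -[] u IH //; have := pos_range u.
case: (pos u) IH => [//|x s] IH xs; rewrite /= rcons_path (IH : path _ _ _) /=.
have : last x s \in x :: s by exact: mem_last.
by move=> /(allP xs) /=; lia.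
Qed.

Lemma size_word b s : size (word b s) = b.
Proof. by elim: b => //= b ->. Qed.

Lemma mem_pos_word b s j : (j \in pos (word b s)) = (0 < j <= b) && (j \in s).
Proof.
elim: b => [|b IH] /=; first by rewrite in_nil; lia.
case: ifP => bs; rewrite ?mem_rcons ?inE IH ?size_word.
  have [->|jb] := eqVneq j b.+1; first by rewrite bs leqnn.
  by rewrite [j <= b.+1]leq_eqVlt (negbTE jb).
have [->|jb] := eqVneq j b.+1; first by rewrite bs ltnn !andbF.
by rewrite [j <= b.+1]leq_eqVlt (negbTE jb).
Qed.

Lemma wordK b s : sorted ltn s -> all (fun x => 0 < x <= b) s -> pos (word b s)
  = s.
Proof.
move=> ss sb; apply: (irr_sorted_eq ltn_trans ltnn) => // [|j];
  first exact: sorted_pos.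
by rewrite mem_pos_word; case js: (j \in s); rewrite ?andbF // (allP sb).
Qed.

Lemma pos_inj u v : size u = size v -> pos u = pos v -> u = v.
Proof.
elim: u v => [|p u IH] [|t v] //= [suv].
have nr w z : size w = size z -> pos w <> rcons (pos z) (size z).+1.
  move=> sw e; have /allP/(_ (size z).+1) := pos_range w.
  by rewrite e mem_rcons mem_head => /(_ isT); lia.
case: p; case: t => e; last by rewrite (IH _ suv e).
- by case/rcons_inj: e => e _; rewrite (IH _ suv e).
- by case: (nr v u (esym suv)); rewrite e.
- by case: (nr u v suv).
Qed.

Lemma count_le_pos_cons m p u :
  count_le m (pos (p :: u)) = count_le m (pos u) + (p && (size u < m)).
Proof. by case: p => /=;
  rewrite ?addn0 // /count_le -cats1 count_cat /= addn0. Qed.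

Lemma count_le_pos m u : size u <= m -> count_le m (pos u) = count id u.
Proof.
move=> um; rewrite -size_pos; apply/eqP; rewrite -all_count.
by apply: sub_all (pos_range u) => x /=; lia.
Qed.

Lemma count_le_nth s k m : sorted ltn s ->
  (k < count_le m s) = (k < size s) && (nth 0 s k <= m).
Proof.
elim: s k => [|x s IH] k //= xs; have ss := path_sorted xs.
rewrite /count_le /= -/(count_le m s); have [xm|mx] := leqP x m.
  by case: k => [|k] /=; rewrite add1n ltnS // IH.
suff H : forall y, y \in x :: s -> m < y.
  have -> : count_le m s = 0.
    apply/eqP; rewrite -leqn0 leqNgt -has_count; apply/hasPn => y ys.
    by have := H y; rewrite inE ys orbT => /(_ isT); lia.
  rewrite add0n ltn0; apply/esym/negP => /andP[ks km].
  by have := H _ (mem_nth 0 (ks : k < size (x :: s))); rewrite ltnNge km.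
move=> y; rewrite inE => /orP[/eqP->//|ys].
have /allP/(_ y ys) : all (ltn x) s by apply: order_path_min xs;
  exact: ltn_trans.
by move=> /=; lia.
Qed.

(** * Admissible fillings of one row *)

(** Conservation of paths: for bottom edges [u] and top edges [v], the difference of the counts up
    to column [m] is the number of paths on the horizontal edge to the right of column [m], hence 0
    or 1. At the right end it is 0 exactly when [q] holds. *)
Definition balanced (q : bool) (u v : seq bool) : Prop :=
  [/\ size u = size v, count id u + q = (count id v).+1 &
      forall m, count_le m (pos v) <= count_le m (pos u) <= (count_le m (pos
        v)).+1].

Definition row_crossings (u v : seq bool) : nat :=
  \sum_(j < size u) two_or_none (count_le j.+1 (pos u) - count_le j (pos v)).

(** The six admissible configurations at the rightmost point: four with one path through it in the
    first alternative, the vacancy and the osculation in the second. *)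
Lemma balanced_cons q p t u v : balanced q (p :: u) (t :: v) <->
  (t = q /\ balanced p u v) \/ ([/\ p != q, t = p & balanced q u v]).
Proof.
have step (w : seq bool) b m : m <= size w -> count_le m (pos (b :: w)) =
  count_le m (pos w).
  by move=> mw; rewrite count_le_pos_cons ltnNge mw andbF addn0.
split=> [[[suv] /= cuv H]|H].
  have H' m : count_le m (pos v) <= count_le m (pos u) <= (count_le m (pos
    v)).+1.
    have [mu|um] := leqP m (size u); first by have := H m; rewrite !step -?suv.
    rewrite !count_le_pos -?suv ?(ltnW um) //; have := H (size u).
    by rewrite !step -?suv // !count_le_pos ?suv.
  (* At [m = size u] the counts are totals, which says that the left edge of the point carries 0 or
     1 paths. *)
  have := H' (size u); rewrite !count_le_pos -?suv // => h.
  move: cuv h {H}; case: p; case: q; case: t => /= cuv h; try lia;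
    by [left; split=> //; split=> //=; lia | right; split=> //; split=> //=;
      lia].
have [suv [cuv tpq]] : size u = size v /\
    (p + count id u + q = (t + count id v).+1 /\
    forall m, count_le m (pos v) <= count_le m (pos u) <= (count_le m (pos
      v)).+1).
  by case: H => [[-> [-> h1 h2]]|[_ -> [-> h1 h2]]]; split=> //; split=> //;
    lia.
split=> [||m]; [by rewrite /= suv | by [] |].
have [mu|um] := leqP m (size u); first by rewrite !step -?suv.
by rewrite !count_le_pos /= -?suv //; lia.
Qed.

Lemma row_crossings_cons p t u v : size u = size v ->
  row_crossings (p :: u) (t :: v) =
  row_crossings u v + two_or_none (p + count id u - count id v).
Proof.
move=> suv; rewrite /row_crossings /= big_ord_recr /=;
  congr (_ + two_or_none _).
  apply: eq_bigr => j _; have ju := ltn_ord j; rewrite !count_le_pos_cons.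
  by rewrite ltnNge ju -suv [_ < j]ltnNge (ltnW ju) !andbF !addn0.
by rewrite !count_le_pos_cons suv ltnn andbF addn0 !count_le_pos ?suv // ltnSn
  andbT addnC.
Qed.

(** By [balanced_cons] and [row_crossings_cons] the two sides obey the same recursion: the branches
    of the scan have 1, respectively 0 or 2, paths at the point. *)
Lemma mem_row_scan q u x : (x \in row_scan q u) <->
  balanced q u x.1 /\ x.2 = row_crossings u x.1.
Proof.
elim: u q x => [|p u IH] q [v z] /=.
  have r0 : row_crossings [::] v = 0 by rewrite /row_crossings big_ord0.
  rewrite r0 {r0}; case: q; split.
  - by rewrite inE => /eqP[-> ->].
  - by case=> -[+ _ _] ->; case: v.
  - by [].
  - by case=> -[].
rewrite mem_cat; split.
  case/orP => [/mapP[[v' z'] /IH /= [bl ->] [-> ->]]|].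
    split; first by apply/balanced_cons; left.
    have [suv cuv _] := bl; rewrite row_crossings_cons //.
    by rewrite (_ : _ - _ = 1) ?addn0 //; lia.
  case: eqP => // /eqP pq /mapP[[v' z'] /IH /= [bl ->] [-> ->]].
  split; first by apply/balanced_cons; right.
  have [suv cuv _] := bl; rewrite row_crossings_cons // -addn1; congr (_ + _).
  move: pq cuv; case: (p); case: (q) => //= _ cuv.
    by rewrite (_ : _ - _ = 2) //; lia.
  by rewrite (_ : _ - _ = 0) //; lia.
case=> bl ->; case: v bl => [[]//|t v] /balanced_cons[[-> bl]|[pq -> bl]].
  have [suv cuv _] := bl; apply/orP; left; apply/mapP;
    exists (v, row_crossings u v).
    by apply/IH.
  by rewrite row_crossings_cons // (_ : _ - _ = 1) ?addn0 //; lia.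
have [suv cuv _] := bl; apply/orP; right; rewrite pq; apply/mapP.
exists (v, row_crossings u v); first by apply/IH.
rewrite row_crossings_cons // -addn1; congr (_, _ + _).
move: pq cuv; case: (p); case: (q) => //= _ cuv.
  by rewrite (_ : _ - _ = 2) //; lia.
by rewrite (_ : _ - _ = 0) //; lia.
Qed.

Lemma uniq_row_scan q u : uniq (row_scan q u).
Proof.
elim: u q => [|p u IH] q /=; first by case: q.
have inj b (f : nat -> nat) : injective f ->
    injective (fun x : seq bool * nat => (b :: x.1, f x.2)).
  by move=> fi [v z] [v' z'] /= [-> /fi ->].
rewrite cat_uniq map_inj_uniq ?IH /=; last exact: (inj q id).
case: eqP => //= /eqP pq; rewrite map_inj_uniq ?IH ?andbT /=;
  last exact: (inj p succn succn_inj).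
by apply/hasPn => _ /mapP[x _ ->]; apply/negP => /mapP[y _ [e]];
  rewrite e eqxx in pq.
Qed.

(** By [count_le_nth], comparing the [k]-th columns amounts to comparing counts at a suitable [m];
    strict growth is the sortedness of [pos v]. *)
Lemma interlacing_balanced n u v : size u = size v -> count id u = n.+1 ->
  count id v = n ->
  interlacing n (pos u) (pos v) <-> balanced false u v.
Proof.
move=> suv cu cv; have [su sv] := (sorted_pos u, sorted_pos v).
have [zu zv] := (size_pos u, size_pos v); rewrite cu in zu; rewrite cv in zv.
have cS s m : count_le m s <= size s by exact: count_size.
split=> [[yd _]|[_ _ H]].
  split; [by []|by rewrite cu cv addn0|move=> m; apply/andP; split].
    case E: (count_le m (pos v)) => [//|k].
    have := count_le_nth k m sv; rewrite E ltnSn zv => /esym/andP[kn dm].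
    by rewrite count_le_nth // zu; have /andP[+ _] := yd k kn; lia.
  case E: (count_le m (pos u)) => [//|[//|k]].
  have := count_le_nth k.+1 m su; rewrite E ltnSn zu => /esym/andP[kn dm].
  by rewrite ltnS count_le_nth // zv; have /andP[_] := yd k kn; lia.
split=> k kn.
  apply/andP; split.
    have := H (nth 0 (pos v) k); have := count_le_nth k (nth 0 (pos v) k) sv.
    have := count_le_nth k (nth 0 (pos v) k) su.
    by rewrite zu zv; lia.
  have := H (nth 0 (pos u) k.+1);
    have := count_le_nth k.+1 (nth 0 (pos u) k.+1) su.
  have := count_le_nth k (nth 0 (pos u) k.+1) sv.
  by rewrite zu zv; lia.
by have := sorted_ltn_nth ltn_trans 0 sv; apply; rewrite ?inE ?zv // ltnW.
Qed.

Lemma Z_count_add_row n b u v P : size u = b -> size v = b ->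
  OP_seq n b (iota 1 n) (pos v) P -> count id u = n.+1 -> count id v = n ->
  interlacing n (pos u) (pos v) ->
  Z_count n.+1 b (add_row n b (pos u) (pos v) P) = row_crossings u v + Z_count
    n b P.
Proof.
move=> su sv oP cu cv il; have [sP _ _] := oP; rewrite size_iota in sP.
set R := add_row _ _ _ _ _.
have -> : Z_count n.+1 b R = \sum_(i < n) \sum_(j < b) two_or_none (crossings R
  i.+1 j.+1) +
    \sum_(j < b) two_or_none (crossings R n.+1 j.+1) by exact: big_ord_recr.
rewrite addnC; congr (_ + _).
  rewrite /row_crossings su; apply: eq_bigr => j _;
    congr (nat_of_bool (two_or_none _)).
  have := crossings_add_row oP _ _ il (ltn_ord j : j.+1 <= b).
  by rewrite !size_pos => /(_ cu cv) e; rewrite /count_le -e addnK.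
apply: eq_bigr => i _; apply: eq_bigr => j _.
by rewrite crossings_add_row_upper.
Qed.

Lemma OP_seq_starts_inj n b ds ds' P : OP_seq n b (iota 1 n) ds P -> OP_seq n b
  (iota 1 n) ds' P ->
  size ds = n -> size ds' = n -> ds = ds'.
Proof.
move=> [_ pP _] [_ pP' _] sd sd'; apply: (@eq_from_nth _ 0);
  first by rewrite sd sd'.
move=> k; rewrite sd => kn; rewrite size_iota in pP pP'.
by have := paths_start (pP k kn); rewrite (paths_start (pP' k kn)) => -[].
Qed.

(** Truncation undoes [add_row], which makes the peeling injective. *)
Lemma add_row_upper n b ys ds P : OP_seq n b (iota 1 n) ds P ->
  P = mkseq (fun k => upper n (nth [::] (add_row n b ys ds P) k)) n.
Proof.
move=> [sP pP _]; rewrite size_iota in sP pP.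
apply: (@eq_from_nth _ [::]); first by rewrite size_mkseq.
move=> k; rewrite sP => kn; rewrite !nth_mkseq //; last exact: ltnW.
rewrite /upper filter_cat (_ : filter _ (row_segment _ _ _) = [::]); last first.
  apply/eqP; rewrite -[_ == _]negbK -has_filter; apply/hasPn => -[i j].
  by rewrite mem_row_segment => /andP[/eqP-> _]; rewrite /= ltnn.
by apply/esym/all_filterP/allP => -[i j] /(paths_mem (pP k kn))[].
Qed.

(** * Enumeration of the path tuples *)

(** For [n] rows, [u] marks the columns entered from below and [l] is the number of vacancies and
    osculations still to be placed. *)
Fixpoint OP_list (b n : nat) (u : seq bool) (l : nat) : seq (seq (seq (nat *
  nat))) :=
  if n is n'.+1 then
    [seq add_row n' b (pos u) (pos x.1) P | x <- row_scan false u,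
       P <- if x.2 <= l then OP_list b n' x.1 (l - x.2) else [::]]
  else if l == 0 then [:: [::]] else [::].

Lemma mem_OP_list b n u l P : size u = b -> count id u = n ->
  (P \in OP_list b n u l) <-> OP_seq n b (iota 1 n) (pos u) P /\ Z_count n b P
    = l.
Proof.
elim: n u l P => [|n IH] u l P su cu.
  rewrite /Z_count big_ord0 /=; case: l => [|l] /=; last by split=> // -[].
  rewrite inE; split=> [/eqP->|[[/size0nil->]]] //.
have [zu sortu] := (size_pos u, sorted_pos u); rewrite cu in zu.
have incu k : k < n -> nth 0 (pos u) k < nth 0 (pos u) k.+1.
  by move=> kn; have := sorted_ltn_nth ltn_trans 0 sortu; apply;
    rewrite ?inE ?zu //; lia.
have topu : nth 0 (pos u) n <= b.
  have := allP (pos_range u) (nth 0 (pos u) n); rewrite su => /(_ _)/andP[] //.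
  by apply: mem_nth; rewrite zu.
split=> [/allpairsPdep[x [P' [/mem_row_scan[bl zx]]]]|[oP zP]].
  case: ifP => // xl iP ->; have [suv cuv _] := bl.
  have cx : count id x.1 = n by move: cuv; rewrite cu addn0 => -[].
  have sx : size x.1 = b by rewrite -suv.
  have [oP' zP'] := (IH _ _ _ sx cx).1 iP.
  have il := (interlacing_balanced suv cu cx).2 bl.
  split; first by apply: OP_seq_add_row => //; rewrite size_pos.
  by rewrite Z_count_add_row // zP' -zx subnKC.
have [ds [P' [sd il oP' eP]]] := OP_seq_split zu incu oP.
have [yd incd] := il.
have sortd : sorted ltn ds.
  by apply/(sortedP 0) => k; rewrite sd => kn; exact: incd.
have alld : all (fun x => 0 < x <= b) ds.
  apply/(all_nthP 0) => k; rewrite sd => kn; have /andP[d1 d2] := yd k kn.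
  have h j : j <= n -> 0 < nth 0 (pos u) j <= b.
    by move=> jn; rewrite -su; apply: (allP (pos_range u));
      rewrite mem_nth // zu ltnS.
  by have := h k (ltnW kn); have := h k.+1 kn; lia.
(* The exit columns are increasing and lie between 1 and [b], so they are encoded by a word. *)
have ed := wordK sortd alld; have sw := size_word b ds.
have cw : count id (word b ds) = n by rewrite -size_pos ed.
set v := word b ds in ed sw cw; rewrite -ed in sd il oP' eP.
have bl : balanced false u v by apply/(interlacing_balanced _ cu cw);
  rewrite ?sw.
have ez := Z_count_add_row su sw oP' cu cw il; rewrite -eP zP in ez.
apply/allpairsPdep; exists (v, row_crossings u v), P'; split=> //.
  by apply/mem_row_scan.
rewrite /= ez leq_addr addKn; by apply/IH.
Qed.

Lemma uniq_OP_list b n u l : size u = b -> count id u = n -> uniq (OP_list b n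
  u l).
Proof.
elim: n u l => [|n IH] u l su cu /=; first by case: ifP.
apply: allpairs_uniq_dep; first exact: uniq_row_scan.
  move=> x /mem_row_scan[[suv cuv _] _]; case: ifP => // _; apply: IH;
    first by rewrite -suv.
  by move: cuv; rewrite cu addn0 => -[].
move=> z z' /allpairsPdep[[v m] [P [xu + ->]]] /allpairsPdep[[v' m'] [P' [xu' +
  ->]]] /=.
have [[suv cuv _] /= em] := (mem_row_scan _ _ _).1 xu.
have [[suv' cuv' _] /= em'] := (mem_row_scan _ _ _).1 xu'.
have cv : count id v = n by move: cuv; rewrite cu addn0 => -[].
have cv' : count id v' = n by move: cuv'; rewrite cu addn0 => -[].
case: ifP => // _ /mem_OP_list; rewrite -suv => /(_ su cv)[oP _].
case: ifP => // _ /mem_OP_list; rewrite -suv' => /(_ su cv')[oP' _] ef.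
have eP : P = P' by rewrite (add_row_upper (pos u) oP) ef -(add_row_upper _
  oP').
subst P'; have ev : v = v'.
  apply: pos_inj; first by rewrite -suv suv'.
  by apply: OP_seq_starts_inj oP oP' _ _; rewrite size_pos.
by subst v'; rewrite em em'.
Qed.

(** Lists and weights satisfy the same recursion over [row_scan], by [OT_weight_row_scan]. *)
Lemma size_OP_list b n u l : count id u = n -> size (OP_list b n u l) =
  OT_weight n (shape u) l.
Proof.
elim: n u l => [|n IH] u l cu.
  have -> : shape u = [::].
    by rewrite /shape; move: cu; rewrite -size_rows => /size0nil->.
  by rewrite OT_weight0 /=; case: l.
rewrite OT_weight_row_scan // size_allpairs_dep sumnE big_map [RHS]big_mkcond
  /=.
rewrite big_seq [RHS]big_seq; apply: eq_bigr => x /mem_row_scan[[_ cuv _] _].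
case: ifP => // _; apply: IH; by move: cuv; rewrite cu addn0 => -[].
Qed.

(** * Conjugation *)

Definition conj_partition (lam : seq nat) : seq nat :=
  mkseq (fun j => conj_part lam j.+1) (part lam 1).

Lemma leq_ext (m n : nat) : (forall k, 0 < k -> (k <= m) = (k <= n)) -> m = n.
Proof.
move=> H; apply/eqP; rewrite eqn_leq; apply/andP; split.
  by case: m H => // m /(_ m.+1 isT); rewrite leqnn => <-.
by case: n H => // n /(_ n.+1 isT); rewrite leqnn => ->.
Qed.

Lemma part_conj lam j : is_partition lam -> 0 < j ->
  part (conj_partition lam) j = conj_part lam j.
Proof.
move=> pl j0; rewrite /part; have [jl|lj] := ltnP j.-1 (part lam 1).
  by rewrite nth_mkseq // prednK.
rewrite nth_default ?size_mkseq //; apply/esym/eqP; rewrite -leqn0 leqNgt.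
by rewrite conj_partE //; lia.
Qed.

Lemma is_partition_conj lam : is_partition lam -> is_partition (conj_partition
  lam).
Proof.
move=> pl; apply/andP; split.
  apply/(sortedP 0) => i; rewrite size_mkseq => il.
  rewrite !nth_mkseq // ?(ltnW il) //=.
  by apply: sub_count => x /=; lia.
by apply/allP => _ /mapP[j + ->]; rewrite mem_iota add0n conj_partE //; lia.
Qed.

Lemma conj_part_conj lam i : is_partition lam -> 0 < i ->
  conj_part (conj_partition lam) i = part lam i.
Proof.
move=> pl i0; apply: leq_ext => k k0.
by rewrite conj_partE ?part_conj ?is_partition_conj // conj_partE.
Qed.

Lemma conj_partitionK lam : is_partition lam -> conj_partition (conj_partition
  lam) = lam.
Proof.
move=> pl; apply: part_inj => // [|i i0];
  first by do 2 apply: is_partition_conj.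
by rewrite part_conj ?is_partition_conj // conj_part_conj.
Qed.

Lemma Y_conj lam i j : is_partition lam -> Y (conj_partition lam) (i, j) <-> Y
  lam (j, i).
Proof.
by move=> pl; rewrite !mem_Y; split=> -[i0 j0]; rewrite ?part_conj ?conj_partE.
Qed.

Lemma adds_square_conj lam mu i j : is_partition lam -> is_partition mu ->
  adds_square lam mu (i, j) -> adds_square (conj_partition lam) (conj_partition
    mu) (j, i).
Proof.
move=> pl pm [nY eY]; split; first by rewrite Y_conj.
apply/seteqP; split=> -[k m] /=.
  move/(Y_conj _ _ pm); rewrite eY => -[h|[-> ->]]; last by right.
  by left; apply/Y_conj.
by case=> [/(Y_conj _ _ pl) h|[-> ->]]; apply/Y_conj; rewrite // eY;
  [left|right].
Qed.

Lemma differ_by_conj lam mu i j : is_partition lam -> is_partition mu ->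
  differ_by lam mu (i, j) -> differ_by (conj_partition lam) (conj_partition mu)
    (j, i).
Proof. by move=> pl pm [] h; [left|right]; exact: adds_square_conj. Qed.

Lemma OT_conj lam l eta : OT lam l eta -> OT (conj_partition lam) l (map
  conj_partition eta).
Proof.
move=> [se pe h0 hl hd];
  have ne k : nth [::] (map conj_partition eta) k = conj_partition (nth [::]
    eta k).
  have [ke|ek] := ltnP k (size eta); first by rewrite (nth_map [::]).
  by rewrite !nth_default ?size_map.
have pk k : k <= l -> is_partition (nth [::] eta k).
  by move=> kl; apply: (all_nthP [::] pe); rewrite se.
split; rewrite ?size_map ?ne ?h0 ?hl //.
  by rewrite all_map; apply: sub_all pe => x /=; exact: is_partition_conj.
move=> k /andP[k0 kl]; rewrite !ne; have [|[i j] d] := hd k;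
  first by rewrite k0.
by exists (j, i); apply: differ_by_conj d; apply: pk; lia.
Qed.

(** Conjugation negates contents and so reverses their order. *)
Lemma ascents_conj lam l eta : OT lam l eta ->
  ascents (fun m n : int => (m > n)%R) (map conj_partition eta) = asc eta.
Proof.
move=> [se pe h0 hl hd]; rewrite /ascents size_map se /=.
have Om k : 0 < k <= l -> Omega (map conj_partition eta) k = (- Omega eta k)%R.
  move=> kl; rewrite /Omega !(nth_map [::]) ?se; try lia.
  have [[i j] d] := hd k kl.
  have pk m : m <= l -> is_partition (nth [::] eta m).
    by move=> ml; apply: (all_nthP [::] pe); rewrite se.
  have d' := differ_by_conj (pk k.-1 _) (pk k _) d.
  by rewrite (DeltaE d) (DeltaE (d' _ _)) /content /=; lia.
apply: eq_in_count => k; rewrite mem_iota => kl.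
by rewrite !Om; lia.
Qed.

Lemma sum_OT_conj n lam l : is_partition lam ->
  \sum_(eta <- OT_enum (conj_partition lam) l) 'C(n + ascents (fun m n : int =>
    (m > n)%R) eta, l) =
  OT_weight n lam l.
Proof.
move=> pl; have back mu eta : OT mu l eta -> map conj_partition (map
  conj_partition eta) = eta.
  move=> [_ /allP pe _ _ _]; rewrite -map_comp -[RHS]map_id;
    apply/eq_in_map => x xe.
  by rewrite /= conj_partitionK // pe.
rewrite /OT_weight (perm_big [seq map conj_partition eta | eta <- OT_enum lam
  l]) /=.
  rewrite big_map big_seq [RHS]big_seq; apply: eq_bigr => eta /mem_OT_enum o.
  by rewrite (ascents_conj o).
apply: uniq_perm; first exact: uniq_OT_enum.
  rewrite map_inj_in_uniq ?uniq_OT_enum // => x y /mem_OT_enum ox /mem_OT_enum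
    oy e.
  by rewrite -(back _ _ ox) e (back _ _ oy).
move=> eta; apply/idP/mapP => [/mem_OT_enum o|[eta' /mem_OT_enum o ->]];
  last first.
  by apply/mem_OT_enum; exact: OT_conj.
exists (map conj_partition eta); last by rewrite (back _ _ o).
by apply/mem_OT_enum; rewrite -(conj_partitionK pl); exact: OT_conj.
Qed.

(** * Frobenius notation and rectangle complements *)

Lemma frobeniusE gamma delta lam :
  is_frobenius gamma delta lam -> frobenius gamma delta = lam.
Proof.
move=> fl; rewrite /frobenius; case: xgetP => [mu _ fm|/(_ lam)//].
exact: frobenius_unique fm fl.
Qed.

Lemma is_frobenius_conj gamma delta lam : size gamma = size delta ->
  is_frobenius gamma delta lam -> is_frobenius delta gamma (conj_partition lam).
Proof.
move=> gd [pl dl gl cl]; split; first exact: is_partition_conj.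
(* The diagonals of [lam] and of its conjugate are counted over ranges of different lengths; both
   extend to the common range [N] without new hits. *)
- rewrite -gd -dl size_mkseq; pose N := maxn (part lam 1) (size lam).
  have ext p n : n <= N -> (forall i, n < i -> p i = false) ->
      count p (iota 1 n) = count p (iota 1 N).
    move=> nN pn; rewrite -(subnKC nN) iotaD count_cat -[LHS]addn0;
      congr (_ + _).
    apply/esym/eqP; rewrite -leqn0 leqNgt -has_count; apply/hasPn => i.
    by rewrite mem_iota => ?; rewrite pn //; lia.
  rewrite (ext _ (part lam 1)) ?leq_maxl //; last first.
    by move=> i il; rewrite /part nth_default ?size_mkseq; lia.
  rewrite (ext _ (size lam)) ?leq_maxr //; last first.
    by move=> i il; rewrite /part nth_default; lia.
  apply: eq_in_count => i; rewrite mem_iota => /andP[i0 _].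
  by rewrite part_conj // conj_partE.
- by move=> i; rewrite -gd => ig; have := cl i ig; rewrite part_conj //; lia.
- by move=> i; rewrite -gd => ig; have := gl i ig; rewrite conj_part_conj //;
    lia.
Qed.

Lemma part_rect_compl a b lam i : is_partition lam -> 0 < i ->
  part (rect_compl a b lam) i = if i <= a then b - part lam (a.+1 - i) else 0.
Proof.
move=> pl i0; rewrite /part /rect_compl nth_filter_pos.
  case: ifP => ia; last by rewrite nth_default // size_map size_rev size_iota;
    lia.
  rewrite (nth_map 0) ?size_rev ?size_iota; last lia.
  by rewrite nth_rev ?size_iota ?nth_iota; [congr (b - part lam _)| |]; lia.
apply/(sortedP 0) => k; rewrite size_map size_rev size_iota => ka.
rewrite !(nth_map 0) ?size_rev ?size_iota; try lia.
rewrite !nth_rev ?size_iota ?nth_iota; try lia.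
by move=> /=; have := @part_mono lam (1 + (a - k.+2)) (1 + (a - k.+1)) pl; lia.
Qed.

Lemma is_partition_rect_compl a b lam : is_partition lam ->
  is_partition (rect_compl a b lam).
Proof.
move=> pl; have pr := part_rect_compl a b pl.
rewrite /is_partition filter_all andbT; apply/(sortedP 0) => k kn /=.
have := pr k.+1 isT; have := pr k.+2 isT; rewrite /part /= => -> ->.
case: ifP => // ka; rewrite (ltnW ka).
by have := @part_mono lam (a.+1 - k.+2) (a.+1 - k.+1) pl; rewrite /part; lia.
Qed.

Lemma rect_compl_conj a b lam : is_partition lam -> size lam <= a -> part lam 1
  <= b ->
  rect_compl b a (conj_partition lam) = conj_partition (rect_compl a b lam).
Proof.
move=> pl sa lb; have pc := is_partition_conj pl;
  have pr := is_partition_rect_compl a b pl.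
apply: part_inj; [exact: is_partition_rect_compl | exact: is_partition_conj |].
move=> i i0; rewrite part_rect_compl // [RHS]part_conj //;
  apply: leq_ext => k k0.
rewrite conj_partE // part_rect_compl //.
have := @conj_partE lam (a.+1 - k) (b.+1 - i) pl.
have := @part_conj lam (b.+1 - i) pl.
by case: (leqP i b) => ib; case: (leqP k a) => ka; lia.
Qed.

(** The [k]-th occupied column, from [k = 0], has [k] occupied columns to its left; the other
    columns to its left are the squares of its row. *)
Lemma rows_pos u : rows u =
  rev (mkseq (fun k => nth 0 (pos u) k - k.+1) (count id u)).
Proof.
elim: u => //= -[] u IH //=; rewrite add1n mkseqS rev_rcons; congr cons.
  by rewrite nth_rcons size_pos ltnn eqxx; have := count_negb u; lia.
rewrite IH; congr rev; apply/eq_in_map => k; rewrite mem_iota => kn.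
by rewrite nth_rcons size_pos ifT //; lia.
Qed.

(* The partition [(b - s_1, ..., b - s_a | a - 1, ..., 0)]. *)
Definition full_frobenius (a b : nat) (s : seq nat) : seq nat :=
  mkseq (fun k => b - nth 0 s k + k.+1) a.

Lemma is_frobenius_full a b u : size u = b -> count id u = a ->
  is_frobenius [seq b - x | x <- pos u] [seq a - x | x <- iota 1 a]
    (full_frobenius a b (pos u)).
Proof.
move=> su cu; have zu := size_pos u; rewrite cu in zu.
have pe k : 0 < k <= a -> part (full_frobenius a b (pos u)) k = b - nth 0 (pos
  u) k.-1 + k.
  by move=> ka; rewrite /part nth_mkseq ?prednK //; lia.
have top k : k < a -> nth 0 (pos u) k <= b.
  move=> ka; have := allP (pos_range u) (nth 0 (pos u) k).
  by rewrite mem_nth ?zu // su => /(_ isT)/andP[].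
have pf : is_partition (full_frobenius a b (pos u)).
  apply/andP; split; last by apply/allP => _ /mapP[k _ ->]; lia.
  apply/(sortedP 0) => k; rewrite size_mkseq => ka.
  rewrite !nth_mkseq // ?(ltnW ka) //=.
  have := sorted_ltn_nth ltn_trans 0 (sorted_pos u).
  move=> /(_ k k.+1); rewrite !inE zu => /(_ (ltnW ka) ka (ltnSn _)).
  by have := top _ ka; lia.
split=> //.
- rewrite size_map zu size_mkseq; apply: count_iota_lt => // i ia.
  by rewrite pe //; lia.
- move=> i; rewrite size_map zu => ia; rewrite pe // (nth_map 0) // zu; lia.
move=> i; rewrite size_map zu => ia; rewrite (nth_map 0) ?size_iota ?nth_iota;
  try lia.
(* Each of the first [a] columns has all [a] squares. *)
have -> : a - (1 + i.-1) + i = a by lia.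
apply/eqP; rewrite eqn_leq; apply/andP; split.
  by rewrite -[leqRHS](size_mkseq (fun k => b - nth 0 (pos u) k + k.+1))
    count_size.
rewrite conj_partE //; try lia.
by rewrite pe; lia.
Qed.

(** The complement of a row [b - s + k.+1] is [s - k.+1], the row length from [rows_pos]. *)
Lemma rect_compl_full a b u : size u = b -> count id u = a ->
  rect_compl a b (full_frobenius a b (pos u)) = shape u.
Proof.
move=> su cu; rewrite /rect_compl /shape rows_pos cu map_rev; congr filter;
  congr rev.
apply: (@eq_from_nth _ 0); first by rewrite size_map size_iota size_mkseq.
move=> k; rewrite size_map size_iota => ka.
rewrite (nth_map 0) ?size_iota // nth_iota // nth_mkseq // /part add1n /=
  nth_mkseq //.
have := allP (pos_range u) (nth 0 (pos u) k);
  rewrite mem_nth ?size_pos ?cu // su.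
by move=> /(_ isT)/andP[]; lia.
Qed.

(** * Transposition of paths *)

Lemma size_labels n (A : {set 'I_n}) : size (labels A) = #|A|.
Proof. by rewrite size_map cardE. Qed.

Lemma sorted_labels n (A : {set 'I_n}) : sorted ltn (labels A).
Proof.
rewrite /labels;
  have -> : enum A = [seq i <- enum 'I_n | i \in A] by rewrite enumT unlock.
rewrite sorted_map; apply: sorted_filter; first by move=> j i k /=; lia.
have : sorted ltn (iota 0 n) by exact: iota_ltn_sorted.
by rewrite -val_enum_ord sorted_map.
Qed.

Lemma labels_range n (A : {set 'I_n}) : all (fun x => 0 < x <= n) (labels A).
Proof. by apply/allP => _ /mapP[i _ ->] /=. Qed.

Lemma labels_setT n : labels [set: 'I_n]%SET = iota 1 n.
Proof.
rewrite /labels (_ : enum [set: 'I_n]%SET = enum 'I_n);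
  last by apply: eq_enum => i; rewrite inE.
by rewrite (map_comp succn val) val_enum_ord -[1]addn0 iotaDl.
Qed.

Lemma OP_OP_seq a b (alpha : {set 'I_a}) (beta : {set 'I_b}) P :
  OP alpha beta P <-> OP_seq a b (labels alpha) (labels beta) P.
Proof.
rewrite /OP /OP_seq -size_labels; split=> -[sP pP oP]; split=> // k ka.
  exact: (osculatingP (pP k (ltnW ka)) (pP k.+1 ka)).1 (oP k ka).
exact: (osculatingP (pP k (ltnW ka)) (pP k.+1 ka)).2 (oP k ka).
Qed.

Lemma card_Z a b P : #|Z a b P| = Z_count a b P.
Proof.
rewrite /Z_count pair_big /= -sum1_card [LHS]big_mkcond /=;
  apply: eq_bigr => -[i j] _.
by rewrite inE /two_or_none /crossings /=; case: ifP.
Qed.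

Lemma card_eq_seq (T : choiceType) (A : set T) (s : seq T) :
  uniq s -> (forall x, x \in s <-> A x) -> A #= `I_(size s).
Proof.
move=> us sA; apply/card_set_bijP; exists (index^~ s); split.
- by move=> x /sA; rewrite /= index_mem.
- by move=> x y; rewrite !inE => /sA xs /sA ys e;
    rewrite -(nth_index x xs) e nth_index.
- move=> i /= si; case: s us sA si => [//|x s] us sA si;
    exists (nth x (x :: s) i).
    by apply/sA; exact: mem_nth.
  by rewrite index_uniq.
Qed.

Definition swap_point (p : nat * nat) : nat * nat := (p.2, p.1).

(** Reflection exchanges the bottom and right sides, hence starts and ends, so the list is
    reversed. *)
Definition transpose (Q : seq (nat * nat)) : seq (nat * nat) := rev (map
  swap_point Q).

Lemma swap_pointK : involutive swap_point. Proof. by case. Qed.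

Lemma transposeK : involutive transpose.
Proof. by move=> Q;
  rewrite /transpose map_rev revK -map_comp (eq_map swap_pointK) map_id. Qed.

Lemma mem_transpose Q i j : ((i, j) \in transpose Q) = ((j, i) \in Q).
Proof.
by rewrite mem_rev -[(i, j)]/(swap_point (j, i)) mem_map //;
  exact: inv_inj swap_pointK.
Qed.

Lemma paths_transpose a b x y Q : paths a b x y Q -> paths b a y x (transpose
  Q).
Proof.
move=> [Q' [-> pQ lQ]]; set m := map swap_point Q'.
have lm : last (y, a) m = (b, x).
  by rewrite /m -[(y, a)]/(swap_point (a, y)) last_map lQ.
exists (rev (belast (y, a) m)); split.
- by rewrite /transpose [map _ _](lastI (y, a) m) rev_rcons lm.
- rewrite -lm rev_path /m -[(y, a)]/(swap_point (a, y)) path_map.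
  apply: sub_path pQ => -[p1 p2] [q1 q2] /orP[] /eqP[-> ->];
    by rewrite /step /= eqxx ?orbT.
- by rewrite -lm; case: (m) => //= p s; rewrite rev_cons last_rcons.
Qed.

(** Reflection interchanges left with up and below with right, hence also the exemptions at the
    start and at the end of the lower path. *)
Lemma osc_transpose a b x y Q R : osc a b x y Q R ->
  osc b a y x (transpose Q) (transpose R).
Proof.
move=> H i j; rewrite !mem_transpose => iQ iR.
have [[j0 h1] [i0 h2] h3 h4] := H _ _ iQ iR; split=> //.
  by move=> ne; apply: h4 => -[ex ey]; apply: ne; rewrite ex ey.
by move=> ne; apply: h3 => -[ex ey]; apply: ne; rewrite ex ey.
Qed.

Lemma OP_seq_transpose a b xs ys P : size xs = size ys ->
  OP_seq a b xs ys P -> OP_seq b a ys xs (map transpose P).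
Proof.
move=> sxy [sP pP oP]; have nt k : k < size ys ->
    nth [::] (map transpose P) k = transpose (nth [::] P k).
  by move=> ks; rewrite (nth_map [::]) // sP sxy.
split; first by rewrite size_map sP.
  by move=> k ks; rewrite nt //; apply: paths_transpose; apply: pP; rewrite sxy.
move=> k ks; rewrite !nt //; last exact: ltnW.
by apply: osc_transpose; apply: oP; rewrite sxy.
Qed.

Lemma Z_count_transpose a b P : Z_count b a (map transpose P) = Z_count a b P.
Proof.
rewrite /Z_count exchange_big; apply: eq_bigr => i _; apply: eq_bigr => j _.
rewrite /crossings count_map; congr (nat_of_bool (two_or_none _)).
by apply: eq_count => Q /=; rewrite mem_transpose.
Qed.

(** * From words back to subsets, and the two counting formulas *)

Lemma OPl_full a b (beta : {set 'I_b}) l P : #|beta| = a ->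
  (P \in OP_list b a (word b (labels beta)) l) <-> OPl [set: 'I_a]%SET beta l P.
Proof.
move=> cb; set u := word b (labels beta).
have pu : pos u = labels beta by apply: wordK;
  [exact: sorted_labels | exact: labels_range].
have su : size u = b by exact: size_word.
have cu : count id u = a by rewrite -size_pos pu size_labels.
rewrite (mem_OP_list _ _ su cu) pu /OPl /= card_Z; split=> -[oP zP]; split=> //.
  by apply/OP_OP_seq; rewrite labels_setT.
by move/OP_OP_seq: oP; rewrite labels_setT.
Qed.

Lemma count_word_labels b (beta : {set 'I_b}) :
  count id (word b (labels beta)) = #|beta|.
Proof.
by rewrite -size_pos wordK ?size_labels // ?sorted_labels ?labels_range.
Qed.

Lemma lambda_of_full a b (beta : {set 'I_b}) : #|beta| = a ->
  lambda_of [set: 'I_a]%SET beta = shape (word b (labels beta)).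
Proof.
move=> cb; have cu := count_word_labels beta; rewrite cb in cu.
have su := size_word b (labels beta).
rewrite /lambda_of labels_setT -{1}(wordK (sorted_labels beta) (labels_range
  beta)).
by rewrite (frobeniusE (is_frobenius_full su cu)) rect_compl_full.
Qed.

Lemma lambda_of_full_transpose a b (alpha : {set 'I_a}) : #|alpha| = b ->
  lambda_of alpha [set: 'I_b]%SET = conj_partition (shape (word a (labels
    alpha))).
Proof.
move=> ca; have cu := count_word_labels alpha; rewrite ca in cu.
have su := size_word a (labels alpha).
rewrite /lambda_of labels_setT -{1}(wordK (sorted_labels alpha) (labels_range
  alpha)).
set u := word a _ in cu su *; have F := is_frobenius_full su cu.
have [pF _ _ _] := F.
rewrite (frobeniusE (is_frobenius_conj _ F)); last first.
  by rewrite !size_map size_pos cu size_iota.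
rewrite rect_compl_conj ?rect_compl_full // ?size_mkseq //.
have [b0|b0] := posnP b; first by rewrite /part nth_default // size_mkseq b0.
rewrite /part nth_mkseq //=.
have := allP (pos_range u) (nth 0 (pos u) 0);
  rewrite mem_nth ?size_pos ?cu // su.
by move=> /(_ isT)/andP[]; lia.
Qed.

Lemma fsum_OT (f : seq (seq nat) -> nat) lam l :
  \big[addn/0]_(eta \in OT lam l) f eta = \sum_(eta <- OT_enum lam l) f eta.
Proof. exact: fsbig_finite (finite_OT lam l). Qed.

Theorem corollary17 (a b : nat) (ha : 0 < a) (hb : 0 < b)
    (alpha : {set 'I_a}) (beta : {set 'I_b})
    (hBP : (alpha, beta) \in BP a b) (l : nat) :
  (alpha = [set: 'I_a]%SET ->
     OPl alpha beta l #=
       `I_(\big[addn/0]_(eta \in OT (lambda_of alpha beta) l)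
             'C(a + ascents (fun m n : int => (m < n)%R) eta, l)))
  /\
  (beta = [set: 'I_b]%SET ->
     OPl alpha beta l #=
       `I_(\big[addn/0]_(eta \in OT (lambda_of alpha beta) l)
             'C(b + ascents (fun m n : int => (m > n)%R) eta, l))).
Proof.
have cab : #|alpha| = #|beta| by move: hBP; rewrite inE => /eqP.
split=> full; subst; rewrite cardsT card_ord in cab.
  have cu := count_word_labels beta; rewrite -cab in cu.
  have su := size_word b (labels beta).
  rewrite fsum_OT lambda_of_full // -/(OT_weight a _ l) -(size_OP_list b l cu).
  by apply: card_eq_seq => [|P]; [exact: uniq_OP_list | exact: OPl_full].
have cu := count_word_labels alpha; rewrite cab in cu.
have su := size_word a (labels alpha).
rewrite fsum_OT lambda_of_full_transpose // sum_OT_conj ?is_partition_shape //.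
(* The tuples on the reflected lattice, with [b] rows and [a] columns, where every row contains the
   end of a path. *)
set L := OP_list a b (word a (labels alpha)) l.
have trK : cancel (map transpose) (map transpose).
  by move=> P; rewrite -map_comp (eq_map transposeK) map_id.
have -> : OT_weight b (shape (word a (labels alpha))) l = size (map (map
  transpose) L).
  by rewrite size_map size_OP_list.
apply: card_eq_seq => [|P].
  by rewrite map_inj_uniq ?uniq_OP_list //; exact: can_inj trK.
have -> : (P \in map (map transpose) L) = (map transpose P \in L).
  by rewrite -[P in LHS]trK mem_map //; exact: can_inj trK.
have szl : size (labels alpha) = size (labels [set: 'I_b]%SET).
  by rewrite !size_labels cardsT card_ord.
rewrite (OPl_full _ _ cab) /OPl /= !card_Z Z_count_transpose; split=> -[oP zP];
  split=> //.
  apply/OP_OP_seq; rewrite -[P]trK; apply: OP_seq_transpose => //.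
  by apply/OP_OP_seq.
by apply/OP_OP_seq; apply: OP_seq_transpose => //; apply/OP_OP_seq.
Qed.
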